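(* Let $q$ be a prime and $k$ a natural number. Let $\mathcal{S}_{q,k}$ be the collection of all $k$-element subsets of $\mathbb{Z}$ that contain a $q^{th}$ power modulo almost every prime. Then: (1) The additive subset density of $\mathcal{S}_{q,k}$ is zero. More specifically, there is a positive constant $a_{q,k}$ depending only on $q$ and $k$ such that for every $N\in\mathbb{N}$, the number of $k$-element subsets of $\{-N,\ldots,-1,0,1,\ldots,N\}$ that contain a $q^{th}$ power modulo almost every prime is at most $a_{q,k}N^{k-(1-\frac{1}{q})}$. (2) The multiplicative subset density of $\mathcal{S}_{q,k}$ is zero. More specifically, there is a positive constant $m_{q,k}$ depending only on $q$ and $k$ such that for every $N\in\mathbb{N}$, the number of $k$-element subsets of $\{\pm p_1^{e_1}p_2^{e_2}\cdots p_N^{e_N} : 0\le e_1,\ldots,e_N\le N\}$ that contain a $q^{th}$ power modulo almost every prime is at most $m_{q,k}\frac{N^{Nk}}{q^N}$.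
   Context: Let $\mathbb{P}=\{p_1<p_2<\cdots\}$ be the set of primes ordered by size. For $S\subseteq\mathbb{P}$, its relative density is $d_{\mathbb{P}}(S)=\lim_{N\to\infty}\frac{|S\cap\{1,\ldots,N\}|}{|\mathbb{P}\cap\{1,\ldots,N\}|}$ when the limit exists. An integer $a$ is a $q^{th}$ power modulo a prime $p$ if $a\equiv x^q \pmod p$ for some integer $x$. A set $A\subseteq\mathbb{Z}$ contains a $q^{th}$ power modulo almost every prime if the set $\{p\in\mathbb{P}: A \text{ contains a } q^{th}\text{ power modulo } p\}$ has relative density $1$ in $\mathbb{P}$. Let $[N]=\{-N,\ldots,-1,0,1,\ldots,N\}$ and $[N]^{\times}=\{\pm p_1^{e_1}p_2^{e_2}\cdots p_N^{e_N}: 0\le e_1,\ldots,e_N\le N\}$ (a set with $2(N+1)^N$ elements). For a set $X$, $\mathfrak{P}_k(X)$ denotes the collection of all $k$-element subsets of $X$. The additive subset density of a collection $\mathcal{S}$ of $k$-element subsets of $\mathbb{Z}$ is $D(\mathcal{S})=\lim_{N\to\infty}\frac{|\mathcal{S}\cap\mathfrak{P}_k([N])|}{\binom{2N+1}{k}}$ if the limit exists; its multiplicative subset density is $D^{\times}(\mathcal{S})=\lim_{N\to\infty}\frac{|\mathcal{S}\cap\mathfrak{P}_k([N]^{\times})|}{\binom{2(N+1)^N}{k}}$ if the limit exists. ''Density zero'' means the limit exists and equals $0$. *)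

(* Defs.v *)
From HB Require Import structures.
From mathcomp Require Import all_boot all_order all_algebra.
From mathcomp Require Import finmap.
From mathcomp Require Import boolp classical_sets reals topology normedtype sequences exp.
From mathcomp Require Import Rstruct Rstruct_topology.
Set Implicit Arguments. Unset Strict Implicit. Unset Printing Implicit Defensive.
Import Order.TTheory GRing.Theory Num.Theory numFieldNormedType.Exports.
From mathcomp Require Import classical_sets.

Local Open Scope ring_scope.
Local Open Scope fset_scope.

Notation RR := Rdefinitions.R.

Definition qth_power_mod (q p : nat) (a : int) : Prop :=
  exists x : int, (a == x ^+ q %[mod p%:Z])%Z.

Definition contains_qth_power_mod (q : nat) (A : {fset int}) (p : nat) : Prop :=
  exists2 a, a \in A & qth_power_mod q p a.

Definition prime_count (P : nat -> Prop) (N : nat) : nat :=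
  #|[set p : 'I_N.+1 | prime p && `[< P p >]]|%N.

Definition rel_density (P : nat -> Prop) (d : RR) : Prop :=
  ((fun N : nat => (prime_count P N)%:R / (prime_count (fun _ => True) N)%:R : RR)
    @ \oo --> d)%classic.

Definition qth_power_ae (q : nat) (A : {fset int}) : Prop :=
  rel_density (contains_qth_power_mod q A) 1.

Definition S_qk (q k : nat) (A : {fset int}) : Prop :=
  #|` A| = k /\ qth_power_ae q A.

(* primes p_1 < p_2 < ...  (here 0-indexed: nth_prime 0 = 2) *)
Lemma ex_prime_above (m : nat) : exists p, (m < p)%N && prime p.
Proof. by case: (prime_above m) => p Hm Hp; exists p; rewrite Hm Hp. Qed.

Definition next_prime (m : nat) : nat := ex_minn (ex_prime_above m).

Fixpoint nth_prime (i : nat) : nat :=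
  match i with
  | 0 => 2
  | i'.+1 => next_prime (nth_prime i')
  end.

Definition add_box (N : nat) : {fset int} :=
  [fset (i%:Z - N%:Z) | i in iota 0 (2 * N).+1].

Definition mul_elt (N : nat) (x : bool * {ffun 'I_N -> 'I_N.+1}) : int :=
  (-1) ^+ x.1 * \prod_(i < N) (nth_prime i)%:Z ^+ (x.2 i).

Definition mul_box (N : nat) : {fset int} :=
  [fset mul_elt x | x in enum [set: bool * {ffun 'I_N -> 'I_N.+1}]].

Definition count_S (q k : nat) (X : {fset int}) : nat :=
  #|` [fset A in fpowerset X | `[< S_qk q k A >]]|.

Definition add_subset_density (q k : nat) (d : RR) : Prop :=
  ((fun N : nat => (count_S q k (add_box N))%:R / ('C((2 * N).+1, k))%:R : RR)
    @ \oo --> d)%classic.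

Definition mul_subset_density (q k : nat) (d : RR) : Prop :=
  ((fun N : nat => (count_S q k (mul_box N))%:R / ('C(2 * (N.+1 ^ N), k))%:R : RR)
    @ \oo --> d)%classic.

(* Main.v *)
(** For an irreducible monic [f] in Z[X], let [nb_roots f p] be the number of
    its roots modulo [p].  The sum of [nb_roots f p / p ^ s] over the primes
    [p <= x], with [s = 1 + 1 / ln x], is [ln (ln x) + O(1)], by an elementary
    argument.  Let [M] be an integer matrix with characteristic polynomial [f].
    A set [A] of degree one primes [(p, r)], [p %| f.[r]], has norm [prod p] and
    defines the lattice of the polynomials [c] of degree less than [deg f] with
    [p %| c.[r]] on [A]; the norm form [det c(M)] is divisible by the norm of
    [A] on it.  By the pigeonhole principle each such lattice has a short
    vector, so there are [O(Y)] sets of norm at most [Y].  Conversely a positive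
    proportion of the [c] in a large box have a squarefree norm, hence come from
    some [A], and the divisibility makes the points of a lattice so far apart
    that each [A] occurs boundedly often; so there are at least [Y / K] sets.
    Expanding the product of [1 + p ^ - s] over the degree one primes gives the
    asymptotics.

    Let [b_e = prod a_i ^ e_i].  If no [b_e] with [e] nonzero modulo [q] is a
    [q]th power, the asymptotics for ['X^q - b_e], for the [q]th cyclotomic
    polynomial and for ['X] give the weighted average of [kummer_sum p =
    sum_e kummer_weight e * (nb_roots ('X^q - b_e) p - 1)], where
    [kummer_weight e = q * (sum e == 0) - 1].  It grows like
    [(q - 1) * ln (ln x)], but [kummer_sum p] vanishes as soon as some [a_i],
    prime to [p], is a [q]th power modulo [p].  Hence the sets counted in the
    theorem are multiplicatively dependent modulo [q]th powers, and these are
    counted by fixing all the elements but one. *)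

Require Import Defs.
From mathcomp Require Import boolp classical_sets unstable reals topology.
From mathcomp Require Import normedtype sequences exp Rstruct Rstruct_topology.
From mathcomp Require Import all_boot all_order all_algebra all_field.
From mathcomp Require Import fingroup perm zify ring lra finmap.
Set Implicit Arguments. Unset Strict Implicit. Unset Printing Implicit Defensive.
Import Order.TTheory GRing.Theory Num.Theory numFieldNormedType.Exports.
Local Open Scope ring_scope.

(** * Linear algebra *)

Lemma rank_diag_mx (F : fieldType) m (r : 'rV[F]_m) :
  \rank (diag_mx r) = #|[set i | r 0 i != 0]|.
Proof.
have rank_le_support (s : 'rV[F]_m) :
    (\rank (diag_mx s) <= #|[set i | s 0%R i != 0%R]|)%N.
  rewrite diag_mx_sum_delta (bigID [pred i | s 0 i == 0]) /= big1 ?add0r.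
    rewrite -sum1dep_card; elim/big_rec2: _ => [|i k A _ rankA].
      by rewrite mxrank0.
    apply: leq_trans (mxrank_add _ _) (leq_add _ rankA).
    by apply: leq_trans (mxrank_scale _ _) _; rewrite mxrank_delta.
  by move=> i /eqP->; rewrite scale0r.
pose s := \row_i (r 0%R i == 0)%:R : 'rV[F]_m.
have sum_unit : diag_mx r + diag_mx s \in unitmx.
  rewrite -raddfD unitmxE det_diag unitfE; apply/prodf_neq0 => i _.
  by rewrite !mxE; case: (eqVneq (r 0 i)) => [->|ri];
    rewrite ?add0r ?oner_neq0 ?addr0.
apply/eqP; rewrite eqn_leq rank_le_support /= -(leq_add2r (\rank (diag_mx s))).
apply: leq_trans (mxrank_add _ _); rewrite (mxrank_unit sum_unit).
rewrite -[X in (_ <= X)%N](card_ord m) -(cardsC [set i | r 0 i != 0]) leq_add2l.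
apply: leq_trans (rank_le_support s) _; apply/subset_leq_card/subsetP => i.
by rewrite !inE mxE negbK; case: (r 0 i == 0); rewrite // mulr0n eqxx.
Qed.

Lemma rmorph_unitmx (R S : comUnitRingType) (g : {rmorphism R -> S}) m
    (A : 'M[R]_m) :
  A \in unitmx -> map_mx g A \in unitmx.
Proof. by rewrite !unitmxE det_map_mx; apply: rmorph_unit. Qed.

Lemma absz_det_unitmx m (A : 'M[int]_m) : A \in unitmx -> `|\det A|%N = 1%N.
Proof. by rewrite unitmxE -topredE /= /GRing.unit /= => /orP [] /eqP ->. Qed.

Lemma int_Smith_diag m (A : 'M[int]_m) :
  exists L R (s : 'rV[int]_m),
    [/\ L \in unitmx, R \in unitmx & A = L *m diag_mx s *m R].
Proof.
have [L uL [R uR [s _ ->]]] := int_Smith_normal_form A.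
exists L, R, (\row_i s`_i); split=> //; congr (_ *m _ *m _).
by apply/matrixP => i j; rewrite !mxE.
Qed.

Definition kernel_basis1 (R : comNzRingType) m (A : 'M[R]_m) (u : 'cV[R]_m) :=
  (forall w : 'cV[R]_m, A *m w = 0 <-> exists t, w = t *: u) /\
  (forall t : R, t *: u = 0 -> t = 0).

Lemma kernel_basis1_diag (R : comUnitRingType) m (s : 'rV[R]_m) i0 :
    s 0 i0 = 0 -> (forall i, i != i0 -> s 0 i \is a GRing.unit) ->
  kernel_basis1 (diag_mx s) (delta_mx i0 0).
Proof.
move=> s0 s_unit; split=> [w|t /matrixP/(_ i0 0)]; last first.
  by rewrite !mxE !eqxx mulr1.
split=> [sw0|[t ->]]; last first.
  rewrite -scalemxAr; apply/matrixP => i j; rewrite mul_diag_mx !mxE.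
  by case: eqVneq => [->|_]; rewrite ?s0 ?mul0r /= ?mulr0.
exists (w i0 0); apply/matrixP => i j; rewrite ord1 !mxE andbT.
have [->|ne] := eqVneq i i0; first by rewrite mulr1.
move/matrixP/(_ i 0): sw0; rewrite mul_diag_mx !mxE mulr0 => sw0.
by rewrite -[LHS](mulKr (s_unit _ ne)) sw0 mulr0.
Qed.

Lemma kernel_basis1_equiv (R : comUnitRingType) m (L A Q : 'M[R]_m) u :
    L \in unitmx -> Q \in unitmx -> kernel_basis1 A u ->
  kernel_basis1 (L *m A *m Q) (invmx Q *m u).
Proof.
move=> uL uQ [kerA u_free]; split=> [w|t tu0].
  rewrite -!mulmxA; split=> [LAw|[t ->]].
    have [t wE] : exists t, Q *m w = t *: u.
      by apply/kerA; rewrite -(mulKmx uL (A *m _)) LAw mulmx0.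
    by exists t; rewrite scalemxAr -wE mulKmx.
  rewrite -scalemxAr mulKVmx //.
  have -> : A *m (t *: u) = 0 by apply/kerA; exists t.
  by rewrite mulmx0.
by apply: u_free; rewrite -(mulKVmx uQ (t *: u)) -scalemxAr tu0 mulmx0.
Qed.

Section SmithModPrime.
Variables (F : fieldType) (p : nat) (m : nat) (A L R : 'M[int]_m).
Variable s : 'rV[int]_m.
Hypotheses (pF : p \in [pchar F]) (uL : L \in unitmx) (uR : R \in unitmx).
Hypothesis A_Smith : A = L *m diag_mx s *m R.

Lemma absz_det_Smith : `|\det A|%N = (\prod_i `|s 0%R i|)%N.
Proof.
rewrite A_Smith !det_mulmx !abszM (absz_det_unitmx uL) (absz_det_unitmx uR).
by rewrite mul1n muln1 det_diag (big_morph _ abszM (erefl _)).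
Qed.

Lemma corank_mod_Smith :
  (m - \rank (map_mx (intr : int -> F) A))%N = #|[set i | (p %| s 0%R i)%Z]|.
Proof.
have -> : \rank (map_mx (intr : int -> F) A) = #|~: [set i | (p %| s 0%R i)%Z]|.
  rewrite A_Smith !map_mxM map_diag_mx mxrankMfree ?row_free_unit
    ?rmorph_unitmx //.
  rewrite -mxrank_tr trmx_mul mxrankMfree ?row_free_unit ?unitmx_tr
    ?rmorph_unitmx //.
  rewrite mxrank_tr rank_diag_mx; apply: eq_card => i.
  by rewrite !inE !mxE (dvdz_pcharf pF).
rewrite -[X in (X - _)%N](card_ord m).
by rewrite -(cardsC [set i | (p %| s 0%R i)%Z]) addnK.
Qed.

End SmithModPrime.

Lemma pexp_corank_dvd_det (F : fieldType) p m (A : 'M[int]_m) :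
    p \in [pchar F] ->
  (p ^ (m - \rank (map_mx (intr : int -> F) A)) %| `|\det A|)%N.
Proof.
move=> pF; have [L [R [s [uL uR AE]]]] := int_Smith_diag A.
rewrite (corank_mod_Smith pF uL uR AE) (absz_det_Smith uL uR AE).
rewrite (bigID (mem [set i | (p %| s 0%R i)%Z])) /= dvdn_mulr //.
rewrite -prod_nat_const; elim/big_rec2: _ => // i a b; rewrite inE => psi ab.
exact: dvdn_mul.
Qed.

Lemma intr_Zp_eq0 (m : nat) (x : int) : (1 < m)%N ->
  (x%:~R == 0 :> 'Z_m) = (m %| x)%Z.
Proof.
move=> m1; have natr_eq0 k : (k%:R == 0 :> 'Z_m) = (m %| k)%N.
  by rewrite -val_eqE /= val_Zp_nat.
case: x => k; rewrite ?NegzE ?rmorphN ?oppr_eq0 -?pmulrn natr_eq0 dvdzE //.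
Qed.

Lemma intr_Zp_unit (m : nat) (x : int) : (1 < m)%N ->
  (x%:~R \is a @GRing.unit 'Z_m) = coprime m `|x|.
Proof.
by move=> m1; case: x => k; rewrite ?NegzE ?rmorphN ?unitrN -?pmulrn unitZpE.
Qed.

Lemma intr_pchar_eq (L : fieldType) p (x y : int) : p \in [pchar L] ->
  (x%:~R == y%:~R :> L) = (p %| x - y)%Z.
Proof. by move=> pL; rewrite (dvdz_pcharf pL) rmorphB subr_eq0. Qed.

Lemma ex_kernel_basis1_Zp (F : fieldType) p k m (A : 'M[int]_m) :
    p \in [pchar F] -> (0 < k)%N -> (p ^ k %| `|\det A|)%N ->
    (m - \rank (map_mx (intr : int -> F) A) <= 1)%N ->
  exists u, kernel_basis1 (map_mx (intr : int -> 'Z_(p ^ k)) A) u.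
Proof.
move=> pF k0 pk_det; have pr_p := pcharf_prime pF.
have [L [R [s [uL uR AE]]]] := int_Smith_diag A.
rewrite (corank_mod_Smith pF uL uR AE) => /card_le1_eqP uniq_ps.
have pk1 : (1 < p ^ k)%N by rewrite -(exp1n k) ltn_exp2r // prime_gt1.
have [i0 psi0] : exists i, (p %| s 0%R i)%Z.
  have : (p %| \prod_i `|s 0%R i|)%N.
    by rewrite -(absz_det_Smith uL uR AE) (dvdn_trans _ pk_det) // dvdn_exp.
  by rewrite Euclid_dvd_prod // big_has => /hasP[i _ psi]; exists i.
have s_unit i : i != i0 -> (s 0 i)%:~R \is a @GRing.unit 'Z_(p ^ k).
  move=> ne; rewrite intr_Zp_unit // coprimeXl // prime_coprime //.
  by apply: contra ne => psi; apply/eqP/uniq_ps; rewrite inE.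
rewrite AE !map_mxM map_diag_mx; eexists.
apply: kernel_basis1_equiv; rewrite ?rmorph_unitmx //.
apply: (@kernel_basis1_diag _ _ _ i0) => [|i /s_unit]; rewrite mxE //.
have : \det (map_mx (intr : int -> 'Z_(p ^ k)) (diag_mx s)) = 0.
  apply/eqP; rewrite det_map_mx det_diag intr_Zp_eq0 // dvdzE.
  by rewrite (big_morph absz abszM (erefl _)) -(absz_det_Smith uL uR AE).
have unit_rest : \prod_(i | i != i0) (map_mx (intr : int -> 'Z_(p ^ k)) s) 0 i
    \is a @GRing.unit 'Z_(p ^ k).
  by apply: rpred_prod => i /s_unit; rewrite mxE.
rewrite map_diag_mx det_diag (bigD1 i0) //= mxE.
by move/(canRL (mulrK unit_rest)); rewrite mul0r.
Qed.

(** * The norm form of an integer matrix *)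

Lemma horner_mx_eigen (R : comNzRingType) n (A : 'M[R]_n.+1)
    (v : 'cV_n.+1) t g :
  A *m v = t *: v -> horner_mx A g *m v = g.[t] *: v.
Proof.
move=> Av; elim/poly_ind: g => [|g a IH].
  by rewrite rmorph0 mul0mx horner0 scale0r.
rewrite rmorphD rmorphM /= horner_mx_X horner_mx_C mulmxDl -mulmxA Av.
by rewrite -scalemxAr IH !hornerE mul_scalar_mx scalerA scalerDl mulrC.
Qed.

(* A commutes with h(A), hence acts on its rank one kernel by some scalar t. *)
Lemma root_of_kernel_basis1 (R : comNzRingType) n (A : 'M[R]_n.+1)
    (h : {poly R}) u :
    kernel_basis1 (horner_mx A h) u ->
  exists t, forall g, horner_mx A g *m u = 0 -> root g t.
Proof.
case=> ker_h u_free.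
have hu0 : horner_mx A h *m u = 0 by apply/ker_h; exists 1; rewrite scale1r.
have [t Au] : exists t, A *m u = t *: u.
  apply/ker_h; rewrite mulmxA (comm_horner_mx h (comm_mx_refl A)) -mulmxA hu0.
  exact: mulmx0.
by exists t => g gu0; apply/rootP/u_free; rewrite -(horner_mx_eigen g Au).
Qed.

Lemma horner_char_poly (R : comNzRingType) n (A : 'M[R]_n) t :
  (char_poly A).[t] = \det (t%:M - A).
Proof.
rewrite -[LHS]/(horner_eval t _) -det_map_mx; congr (\det _).
by apply/matrixP => i j; rewrite !mxE /= /horner_eval !hornerE hornerMn hornerX.
Qed.

Lemma det_horner_mx_common_root (R : comNzRingType) n (A : 'M[R]_n.+1) h t :
  root (char_poly A) t -> root h t -> \det (horner_mx A h) = 0.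
Proof.
move=> /rootP At /factor_theorem [g ->].
rewrite rmorphM rmorphB /= horner_mx_X horner_mx_C det_mulmx.
by rewrite -[A - _]opprB -scaleN1r detZ -horner_char_poly At !mulr0.
Qed.

Lemma char_poly_similar (F : fieldType) n (P A B : 'M[F]_n) :
  P \in unitmx -> P *m A = B *m P -> char_poly A = char_poly B.
Proof.
rewrite unitmxE unitfE => P0 PA.
apply: (@mulfI _ (\det (map_mx polyC P)));
  first by rewrite det_map_mx polyC_eq0.
rewrite -det_mulmx [RHS]mulrC -det_mulmx; congr (\det _).
by rewrite mulmxBr mulmxBl -!map_mxM PA scalar_mxC.
Qed.

Section Diagonalized.
Variables (F : fieldType) (n : nat) (A P : 'M[F]_n.+1) (z : 'rV[F]_n.+1).
Hypotheses (uP : P \in unitmx) (PA : P *m A = diag_mx z *m P).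

Lemma char_poly_diagonalized :
  char_poly A = \prod_(x <- codom (z 0)) ('X - x%:P).
Proof.
rewrite (char_poly_similar uP PA) char_poly_trig ?diag_mx_is_trig //
  big_image /=.
by apply: eq_bigr => i _; rewrite mxE eqxx.
Qed.

Lemma root_char_poly_diagonalized x :
  root (char_poly A) x = (x \in codom (z 0)).
Proof. by rewrite char_poly_diagonalized root_prod_XsubC. Qed.

Lemma corank_horner_mx_diagonalized h :
  (n.+1 - \rank (horner_mx A h))%N = #|[set i | root h (z 0%R i)]|.
Proof.
have AE : A = invmx P *m diag_mx z *m P by rewrite -mulmxA -PA mulKmx.
have -> : \rank (horner_mx A h) = \rank (diag_mx (map_mx (horner h) z)).
  rewrite AE -[X in _ *m X](invmxK P) horner_mx_uconj ?unitmx_inv // invmxK.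
  rewrite horner_mx_diag mxrankMfree ?row_free_unit //.
  by rewrite -mxrank_tr trmx_mul mxrankMfree ?row_free_unit ?unitmx_tr
    ?unitmx_inv ?mxrank_tr.
rewrite rank_diag_mx -[X in (X - _)%N](card_ord n.+1).
rewrite -(cardsC [set i | map_mx (horner h) z 0 i != 0]) addKn.
by apply: eq_card => i; rewrite !inE negbK mxE.
Qed.

End Diagonalized.

Lemma diagonalize_separable (L : closedFieldType) n (A : 'M[L]_n.+1) :
    separable_poly (char_poly A) ->
  exists P (z : 'rV_n.+1),
    [/\ P \in unitmx, injective (z 0) & P *m A = diag_mx z *m P].
Proof.
move=> sepA; have [rs] := closed_field_poly_normal (char_poly A).
rewrite (monicP (char_poly_monic A)) scale1r => AE.
have [|P uP /diagonalizable_forPex [z /(simmxP uP) PA]] :=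
  (@diagonalizableP _ _ A).2 _.
  exists rs; first by rewrite -separable_prod_XsubC -AE.
  by rewrite -AE mxminpoly_dvd_char.
exists P, z; split=> //; apply/injectiveP.
rewrite -[injectiveb _]/(uniq (codom (z 0))) -separable_prod_XsubC.
by rewrite -(char_poly_diagonalized uP PA).
Qed.

Lemma root_intr_Zp m (g : {poly int}) t : (1 < m)%N ->
  root (map_poly intr g) (t%:~R : 'Z_m) = (m %| g.[t])%Z.
Proof. by move=> m1; rewrite rootE horner_map /= intr_Zp_eq0. Qed.

Lemma root_intr_pchar (L : fieldType) p (g : {poly int}) t : p \in [pchar L] ->
  root (map_poly intr g) (t%:~R : L) = (p %| g.[t])%Z.
Proof. by move=> pL; rewrite rootE horner_map /= (dvdz_pcharf pL). Qed.

Lemma dvdz_horner_sub (g : {poly int}) t t' : (t' - t %| g.[t'] - g.[t])%Z.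
Proof.
elim/poly_ind: g => [|g a IH]; first by rewrite !horner0 subrr.
rewrite !hornerE.
have -> : g.[t'] * t' + a - (g.[t] * t + a)
  = (g.[t'] - g.[t]) * t' + g.[t] * (t' - t).
  by ring.
by apply: rpredD; [apply: dvdz_mulr | apply: dvdz_mull].
Qed.

Lemma horner_taylor1 (R : comNzRingType) (g : {poly R}) t t' :
  exists h, g.[t'] = g.[t] + g^`().[t] * (t' - t) + h * (t' - t) ^+ 2.
Proof.
elim/poly_ind: g => [|g a [h IH]];
  first by exists 0; rewrite deriv0 !horner0; ring.
exists (h * t' + g^`().[t]).
rewrite derivD derivM derivX derivC.
rewrite !(hornerD, hornerM, hornerX, hornerC, mulr1, addr0) IH.
by move: (g.[t]) (g^`().[t]) => b b'; ring.
Qed.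

Definition norm_form n (M : 'M[int]_n.+1) (c : 'rV[int]_n.+1) : int :=
  \det (horner_mx M (rVpoly c)).

Definition unramified (f : {poly int}) (p : nat) : bool :=
  separable_poly (map_poly (intr : int -> 'F_p) f).

Section NormForm.
Variables (n : nat) (M : 'M[int]_n.+1).
Local Notation f := (char_poly M).
Local Notation N := (norm_form M).

Lemma norm_form_neq0 (c : 'rV[int]_n.+1) :
  irreducible_poly f -> c != 0 -> N c != 0.
Proof.
move=> f_irr; apply: contra => /eqP Nc0.
have fc0 : ~~ coprimep f (rVpoly c).
  apply/negP => /Bezout_coprimepP [[u v] /= /eqpP [[d e] /= /andP [_ e0] uvE]].
  move/(congr1 (fun h => \det (horner_mx M h))): uvE.
  rewrite !linearZ /= rmorphD !rmorphM rmorph1 /= Cayley_Hamilton mulr0 add0r.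
  rewrite !detZ det_mulmx -/(N c) Nc0 det1 !mulr0 mulr1 => /esym/eqP.
  by rewrite expf_eq0 (negPf e0) andbF.
rewrite irreducible_poly_coprime // negbK in fc0.
rewrite -(rVpolyK c); apply: contraTT fc0 => c0.
have rc0 : rVpoly c != 0 by apply: contraNneq c0 => ->; rewrite linear0.
by apply/negP => /(dvdp_leq rc0); rewrite size_char_poly leqNgt ltnS size_poly.
Qed.

Lemma root_of_dvd_norm_form (F : fieldType) p k (c : 'rV[int]_n.+1) :
    p \in [pchar F] -> (0 < k)%N -> (p ^ k %| `|N c|)%N ->
    (n.+1 - \rank (map_mx (intr : int -> F) (horner_mx M (rVpoly c))) <= 1)%N ->
  exists t, ((p ^ k)%N %| f.[t])%Z && ((p ^ k)%N %| (rVpoly c).[t])%Z.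
Proof.
move=> pF k0 pk_N corank1; have pr_p := pcharf_prime pF.
have pk1 : (1 < p ^ k)%N by rewrite -(exp1n k) ltn_exp2r // prime_gt1.
have [u] := ex_kernel_basis1_Zp pF k0 pk_N corank1.
rewrite map_horner_mx => ker_u; have [t root_t] := root_of_kernel_basis1 ker_u.
exists (t : nat)%:Z; rewrite -!(root_intr_Zp _ _ pk1) -pmulrn natr_Zp.
rewrite !root_t //; first by apply/ker_u.1; exists 1; rewrite scale1r.
by rewrite -map_horner_mx Cayley_Hamilton map_mx0 mul0mx.
Qed.

Section LocalPrime.
Variables (p : nat) (pr_p : prime p) (p_unram : unramified f p).

Lemma diagonalize_mod_p : exists (L : fieldType) P (z : 'rV[L]_n.+1),
  [/\ p \in [pchar L], P \in unitmx, injective (z 0) &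
      P *m map_mx intr M = diag_mx z *m P].
Proof.
have [L [h _]] := countable_algebraic_closure 'F_p.
have [|P [z [uP zI PM]]] := @diagonalize_separable L _ (map_mx intr M).
  rewrite -map_char_poly (_ : map_poly _ _ = map_poly h (map_poly intr f)).
    by rewrite separable_map.
  by rewrite -map_poly_comp; apply: eq_map_poly => x; rewrite /= rmorph_int.
by exists L, P, z; split=> //; apply: (rmorph_pchar h); apply: pchar_Fp.
Qed.

Lemma simple_root_lift_unique t t' :
    ((p ^ 2)%N %| f.[t])%Z -> ((p ^ 2)%N %| f.[t'])%Z -> (p %| t' - t)%Z ->
  ((p ^ 2)%N %| t' - t)%Z.
Proof.
move=> ft ft' pt; have [h taylor] := horner_taylor1 f t t'.
have p2_sq : ((p ^ 2)%N %| ((t' - t) ^+ 2)%R)%Z.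
  by have := dvdz_exp2r 2 pt; rewrite -rmorphXn natrXE.
have p2_lin : ((p ^ 2)%N %| (f^`().[t] * (t' - t))%R)%Z.
  have -> : f^`().[t] * (t' - t) = f.[t'] - f.[t] - h * (t' - t) ^+ 2.
    by rewrite taylor; ring.
  by rewrite !rpredB // dvdz_mull.
have p_deriv : ~~ (p %| f^`().[t])%Z.
  rewrite -(root_intr_pchar _ _ (pchar_Fp pr_p)) -deriv_map.
  move: p_unram; rewrite /unramified unlock => /coprimep_root; apply.
  rewrite (root_intr_pchar _ _ (pchar_Fp pr_p)) (dvdz_trans _ ft) //.
  by rewrite dvdzE /= dvdn_exp.
rewrite Gauss_dvdzr // in p2_lin.
by rewrite coprimezE coprimeXl // prime_coprime.
Qed.

Lemma pexp_nb_roots_dvd_norm_form (c : 'rV[int]_n.+1) (s : seq nat) :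
    uniq s ->
    {in s, forall r,
      [&& (r < p)%N, (p %| f.[r%:Z])%Z & (p %| (rVpoly c).[r%:Z])%Z]} ->
  (p ^ size s %| `|N c|)%N.
Proof.
move=> s_uniq s_roots; have [L [P [z [pL uP zI PM]]]] := diagonalize_mod_p.
apply: dvdn_trans (pexp_corank_dvd_det _ pL); rewrite dvdn_exp2l //.
rewrite map_horner_mx (corank_horner_mx_diagonalized uP PM) cardE.
rewrite -(size_map (fun r : nat => (r%:Z)%:~R : L)) -(size_map (z 0)).
apply: uniq_leq_size => [|_ /mapP [r /s_roots /and3P [_ fr cr] ->]].
  rewrite map_inj_in_uniq // =>
    x y /s_roots /and3P [xp _ _] /s_roots /and3P [yp _ _].
  move/eqP; rewrite (intr_pchar_eq _ _ pL) -eqz_mod_dvd !modz_nat eqz_nat.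
  by rewrite !modn_small // => /eqP.
have : root (char_poly (map_mx intr M)) ((r%:Z)%:~R : L).
  by rewrite -map_char_poly (root_intr_pchar _ _ pL).
rewrite (root_char_poly_diagonalized uP PM) => /codomP [i ri].
by apply/mapP; exists i; rewrite // mem_enum inE -ri (root_intr_pchar _ _ pL).
Qed.

Lemma residue_root_of_dvd_norm_form (c : 'rV[int]_n.+1) :
    (p %| `|N c|)%N -> ~~ (p ^ 2 %| `|N c|)%N ->
  exists r : nat,
    [&& (r < p)%N, (p %| f.[r%:Z])%Z & (p %| (rVpoly c).[r%:Z])%Z].
Proof.
move=> pN p2N; have pF := pchar_Fp pr_p.
have [|t /andP [ft ct]] := root_of_dvd_norm_form pF (ltn0Sn 0) pN.
  rewrite leqNgt; apply: contra p2N => corank2.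
  exact: dvdn_trans (dvdn_exp2l _ corank2) (pexp_corank_dvd_det _ pF).
rewrite expn1 in ft ct; have p0 : p%:Z != 0 by case: p pr_p.
have rE : (`|(t %% p)%Z|%N)%:Z = (t %% p)%Z by rewrite gez0_abs // modz_ge0.
have root_mod g : (p %| g.[t])%Z -> (p %| g.[(t %% p)%Z])%Z.
  have pt : (p %| (t - (t %% p)%Z)%R)%Z.
    by rewrite {1}(divz_eq t p) addrK dvdz_mull.
  by have := dvdz_trans pt (dvdz_horner_sub g _ t) => + gt; rewrite rpredBl.
exists `|(t %% p)%Z|%N; rewrite -ltz_nat rE ltz_pmod ?ltz_nat ?prime_gt0 //=.
by rewrite !root_mod.
Qed.

End LocalPrime.

End NormForm.

Lemma ex_unramified_above (f : {poly int}) :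
    f \is monic -> irreducible_poly f ->
  exists B : nat, forall p, prime p -> (B < p)%N -> unramified f p.
Proof.
move=> f_monic f_irr.
have f'0 : f^`() != 0.
  case: f_irr => sf _; have d0 : (0 < (size f).-1)%N by rewrite -subn1 subn_gt0.
  apply/eqP => /polyP /(_ (size f).-2); rewrite coef_deriv coef0 prednK //.
  rewrite -lead_coefE (monicP f_monic) => /eqP.
  by rewrite pnatr_eq0 gtn_eqF.
have : coprimep f f^`().
  rewrite irreducible_poly_coprime //; apply/negP => /(dvdp_leq f'0).
  by rewrite leqNgt lt_size_deriv // monic_neq0.
case/Bezout_coprimepP=> [[u v] /= /eqpP [[d e] /= /andP [_ e0] uvE]].
exists `|e|%N => p pr_p; rewrite /unramified unlock => ep.
apply/Bezout_coprimepP;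
  exists (d%:~R *: map_poly intr u, d%:~R *: map_poly intr v) => /=.
rewrite deriv_map -!scalerAl -scalerDr -!rmorphM -rmorphD -map_polyZ /= uvE.
rewrite map_polyZ rmorph1 alg_polyC -alg_polyC eqp_scale //.
rewrite -(dvdz_pcharf (pchar_Fp pr_p)) dvdzE; apply: contraL ep => /dvdn_leq.
by rewrite -leqNgt absz_gt0; apply.
Qed.

Section SquareLattices.
Variables (n : nat) (M : 'M[int]_n.+1) (p : nat).
Local Notation f := (char_poly M).
Local Notation N := (norm_form M).
Variables (L : fieldType) (P : 'M[L]_n.+1) (z : 'rV[L]_n.+1).
Hypotheses (pr_p : prime p) (p_unram : unramified f p) (pL : p \in [pchar L]).
Hypotheses (uP : P \in unitmx) (PM : P *m map_mx intr M = diag_mx z *m P).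

(* If p^2 divides N c, then c vanishes modulo p^2 at a lift of one of the roots
   z 0 i of f (the case i = j), or modulo p at two of them. *)
Definition square_lattice (ij : 'I_n.+1 * 'I_n.+1) (c : 'rV[int]_n.+1) : Prop :=
  if ij.1 == ij.2 then
    exists t : int, [/\ t%:~R = z 0 ij.1, ((p ^ 2)%N %| f.[t])%Z &
                        ((p ^ 2)%N %| (rVpoly c).[t])%Z]
  else root (map_poly intr (rVpoly c)) (z 0 ij.1) &&
       root (map_poly intr (rVpoly c)) (z 0 ij.2).

Lemma square_latticeB ij c c' :
  square_lattice ij c -> square_lattice ij c' -> square_lattice ij (c - c').
Proof.
rewrite /square_lattice; case: eqP => [_ [t [tz ft ct]] [t' [tz' ft' ct']]|_].
  exists t; split; rewrite // raddfB /= !hornerE rpredB //.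
  have pt : (p %| t - t')%Z by rewrite -(intr_pchar_eq _ _ pL) tz tz'.
  have := dvdz_trans (simple_root_lift_unique pr_p p_unram ft' ft pt)
    (dvdz_horner_sub (rVpoly c') t' t).
  by rewrite rpredBr.
rewrite raddfB rmorphB /= !rootE !hornerE => /andP [/eqP -> /eqP ->].
by move=> /andP [/eqP -> /eqP ->]; rewrite subrr eqxx.
Qed.

Lemma square_latticeZ ij (m : int) c :
  ~~ (p %| m)%Z -> square_lattice ij (m *: c) -> square_lattice ij c.
Proof.
move=> pm; rewrite /square_lattice; case: eqP => [_ [t [tz ft mct]]|_].
  exists t; split; rewrite // -(@Gauss_dvdzr _ m).
    by move: mct; rewrite linearZ /= hornerZ.
  by rewrite coprimezE coprimeXl // prime_coprime.
have m0 : m%:~R != 0 :> L by rewrite -(dvdz_pcharf pL).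
by rewrite linearZ /= map_polyZ /= !rootE !hornerZ !mulf_eq0 (negPf m0).
Qed.

Lemma dvd_norm_form_square_lattice ij c :
  square_lattice ij c -> (p ^ 2 %| `|N c|)%N.
Proof.
case: ij => i j; rewrite /square_lattice /=;
  case: eqVneq => [_ [t [_ ft ct]]|ij czij].
  have p2 : (1 < p ^ 2)%N by rewrite -(exp1n 2) ltn_exp2r // prime_gt1.
  have : ((N c)%:~R == 0 :> 'Z_(p ^ 2)); last by rewrite intr_Zp_eq0.
  rewrite -det_map_mx map_horner_mx.
  rewrite (@det_horner_mx_common_root _ _ _ _ t%:~R) //.
    by rewrite -map_char_poly root_intr_Zp.
  by rewrite root_intr_Zp.
apply: dvdn_trans (pexp_corank_dvd_det _ pL); rewrite dvdn_exp2l //.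
rewrite map_horner_mx (corank_horner_mx_diagonalized uP PM); apply/card_gt1P.
by exists i, j; rewrite !inE; case/andP: czij.
Qed.

Lemma square_lattice_of_dvd_norm_form c :
  (p ^ 2 %| `|N c|)%N -> exists ij, square_lattice ij c.
Proof.
move=> p2N; have corankE :=
  corank_horner_mx_diagonalized uP PM (map_poly intr (rVpoly c)).
have [] := leqP
  (n.+1 - \rank (map_mx (intr : int -> L) (horner_mx M (rVpoly c)))) 1.
  case/(root_of_dvd_norm_form pL (ltn0Sn 1) p2N) => t /andP [ft ct].
  have : root (char_poly (map_mx intr M)) (t%:~R : L).
    rewrite -map_char_poly (root_intr_pchar _ _ pL) (dvdz_trans _ ft) //.
    by rewrite dvdzE /= dvdn_exp.
  rewrite (root_char_poly_diagonalized uP PM) => /codomP [i ti].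
  by exists (i, i); rewrite /square_lattice eqxx; exists t.
rewrite map_horner_mx corankE => /card_gt1P [i [j []]];
  rewrite !inE => ci cj ij.
by exists (i, j); rewrite /square_lattice (negPf ij) ci.
Qed.

End SquareLattices.

(** * Size of the norm form *)

Definition entrywise_le (R : numDomainType) m n (A : 'M[R]_(m, n)) (b : R) :=
  forall i j, `|A i j| <= b.

Lemma det_le (R : numDomainType) n (A : 'M[R]_n) b :
  entrywise_le A b -> `|\det A| <= n`!%:R * b ^+ n.
Proof.
move=> Ab; apply: le_trans (ler_norm_sum _ _ _) _.
rewrite -card_Sn mulr_natl -sumr_const.
apply: ler_sum => s _; rewrite normrM normrX normrN1 expr1n mul1r normr_prod.
rewrite -[X in b ^+ X]card_ord -prodr_const.
by apply: ler_prod => i _; rewrite normr_ge0 Ab.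
Qed.

Lemma det_sub_prod_diag_le (R : numDomainType) n (A : 'M[R]_n.+1) a b :
    (forall i j, i != j -> `|A i j| <= b) -> (forall i, `|A i i| <= a) ->
    b <= a -> 0 <= b ->
  `|\det A - \prod_i A i i| <= n.+1`!%:R * (b * a ^+ n).
Proof.
move=> Ab Aa ba b0; have a0 := le_trans b0 ba.
rewrite /determinant (bigD1 1%g) //= odd_perm1 mul1r.
rewrite (eq_bigr (fun i => A i i)) => [|i _]; last by rewrite perm1.
rewrite addrC addrK; apply: le_trans (ler_norm_sum _ _ _) _.
rewrite -card_Sn mulr_natl -sumr_const [X in _ <= X](bigD1 1%g) //=
  -[X in X <= _]add0r.
apply: lerD; first by rewrite mulr_ge0 ?exprn_ge0.
apply: ler_sum => s s1; have [i si] : exists i, s i != i.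
  apply/existsP; apply: contraR s1; rewrite negb_exists => /forallP fixs.
  apply/eqP/permP => i; rewrite perm1; apply/eqP.
  by have := fixs i; rewrite negbK.
rewrite normrM normrX normrN1 expr1n mul1r normr_prod (bigD1 i) //=.
apply: ler_pM => //; first by rewrite prodr_ge0.
  by apply: Ab; rewrite eq_sym.
have -> : a ^+ n = \prod_(j < n.+1 | j != i) a.
  by rewrite prodr_const cardC1 card_ord.
apply: ler_prod => j _; rewrite normr_ge0 /=.
by case: (eqVneq j (s j)) => [<-|/Ab /le_trans]; last exact.
Qed.

Lemma det_scalar_add_ge (R : realDomainType) n (B : 'M[R]_n.+1) t b :
    entrywise_le B b -> (2 + (n.+1`! * 2 ^ n)%:R) * b <= t ->
  b ^+ n.+1 <= \det (t%:M + B).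
Proof.
move=> Bb; set w := (n.+1`! * 2 ^ n)%:R => t_large.
have b0 : 0 <= b := le_trans (normr_ge0 _) (Bb 0 0).
have w1 : 1 <= w by rewrite ler1n muln_gt0 fact_gt0 expn_gt0.
have wb : b <= w * b by rewrite ler_peMl.
have diag_ge i : t - b <= (t%:M + B) i i.
  rewrite !mxE eqxx mulr1n; have := Bb i i.
  by rewrite ler_norml => /andP [? _]; lra.
have diag_le i : `|(t%:M + B) i i| <= t + b.
  rewrite !mxE eqxx mulr1n; have := Bb i i; rewrite !ler_norml => /andP [? ?].
  by apply/andP; split; lra.
have off_le i j : i != j -> `|(t%:M + B) i j| <= b.
  by move=> /negPf ij; rewrite !mxE ij mulr0n add0r Bb.
have prod_ge : (t - b) ^+ n.+1 <= \prod_i (t%:M + B) i i.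
  rewrite -[X in _ ^+ X]card_ord -prodr_const; apply: ler_prod => i _.
  by rewrite diag_ge andbT; lra.
have /ler_normlP [rest _] := det_sub_prod_diag_le off_le diag_le ltac:(lra) b0.
have rest_le : n.+1`!%:R * (b * (t + b) ^+ n) <= w * b * (t - b) ^+ n.
  rewrite /w natrM natrX -!mulrA ler_wpM2l // mulrCA ler_wpM2l // -exprMn.
  by rewrite lerXn2r ?nnegrE; lra.
have : b * b ^+ n <= (t - b - w * b) * (t - b) ^+ n.
  by apply: ler_pM; rewrite ?exprn_ge0 ?lerXn2r ?nnegrE //; lra.
by rewrite -exprS mulrBl -exprS; lra.
Qed.

Lemma horner_mx_rVpoly_sum (R : comNzRingType) n (M : 'M[R]_n.+1)
    (c : 'rV[R]_n.+1) :
  horner_mx M (rVpoly c) = \sum_k c 0 k *: M ^+ k.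
Proof.
rewrite {1}(row_sum_delta c) linear_sum raddf_sum /=; apply: eq_bigr => k _.
by rewrite linearZ /= linearZ /= rVpoly_delta rmorphXn /= horner_mx_X.
Qed.

Lemma horner_mx_entrywise_le (R : numDomainType) n (M : 'M[R]_n.+1) :
  exists2 E : R, 0 <= E & forall (c : 'rV[R]_n.+1) b,
    entrywise_le c b -> entrywise_le (horner_mx M (rVpoly c)) (E * b).
Proof.
exists (\sum_(k < n.+1) \sum_i \sum_j `|(M ^+ k) i j|).
  by rewrite !sumr_ge0 // => k _; rewrite !sumr_ge0 // => i _; rewrite sumr_ge0.
move=> c b cb i j; rewrite horner_mx_rVpoly_sum summxE.
apply: le_trans (ler_norm_sum _ _ _) _; rewrite mulr_suml;
  apply: ler_sum => k _.
rewrite mxE normrM mulrC ler_pM //.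
rewrite (bigD1 i) //= (bigD1 j) //= -addrA lerDl addr_ge0 ?sumr_ge0 // => l _.
by rewrite sumr_ge0.
Qed.

Lemma norm_form_le n (M : 'M[int]_n.+1) : exists2 C : nat, (0 < C)%N &
  forall (c : 'rV[int]_n.+1) (Z : nat), entrywise_le c Z%:Z ->
    (`|norm_form M c| <= C * Z ^ n.+1)%N.
Proof.
have [E E0 entries_le] := horner_mx_entrywise_le M.
exists (n.+1`! * `|E|.+1 ^ n.+1)%N; first by rewrite muln_gt0 fact_gt0 expn_gt0.
move=> c Z /entries_le/det_le;
  rewrite -abszE -(gez0_abs E0) -PoszM natz -natrXE.
rewrite -rmorphXn -PoszM lez_nat => /leq_trans; apply.
by rewrite -mulnA -expnMn leq_mul2l leq_exp2r // leq_mul2r leqnSn !orbT.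
Qed.

(** * Sets of degree one primes *)

Lemma ex_floor_root (d C m : nat) : (0 < d)%N -> (0 < C)%N ->
  exists l, (C * l ^ d <= m < C * l.+1 ^ d)%N.
Proof.
move=> d0 C0; have le_self l : (C * l ^ d <= m)%N -> (l <= m)%N.
  apply: leq_trans; apply: leq_trans (leq_pmull _ C0).
  by case: l => // l; rewrite -[X in (X <= _)%N]expn1 leq_pexp2l.
have [|l l_le l_max] := ex_maxnP _ le_self;
  first by exists 0%N; rewrite exp0n // muln0.
by exists l; rewrite l_le ltnNge; apply/negP => /l_max; rewrite ltnn.
Qed.

Lemma card_ord_ltn x m (S : {pred 'I_x}) :
  {in S, forall i : 'I_x, (i < m)%N} -> (#|S| <= m)%N.
Proof.
move=> Sm; rewrite cardE -(size_map val) -[X in (_ <= X)%N](size_iota 0).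
apply: uniq_leq_size;
  first by rewrite map_inj_uniq ?enum_uniq //; apply: val_inj.
by move=> _ /mapP [i + ->]; rewrite mem_enum mem_iota => /Sm.
Qed.

Lemma card_le_fibers (S T : finType) (A : {set S}) (fiber : T -> {set S})
    (B : {set T}) K :
    (forall a, a \in A -> exists2 t, t \in B & a \in fiber t) ->
    (forall t, t \in B -> (#|fiber t| <= K)%N) ->
  (#|A| <= K * #|B|)%N.
Proof.
move=> A_cover fiber_le; apply: (@leq_trans #|\bigcup_(t in B) fiber t|).
  by apply/subset_leq_card/subsetP => a /A_cover ?; apply/bigcupP.
by rewrite mulnC -sum_nat_const (leq_trans (card_big_setU _ _ _)) // leq_sum.
Qed.

Lemma pigeonhole_residues (I T : finType) (A : {set I}) (m : I -> nat)
    (g : I -> T -> int) :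
    {in A, forall i, (0 < m i)%N} -> (\prod_(i in A) m i < #|T|)%N ->
  exists s t, s != t /\ {in A, forall i, (m i %| g i s - g i t)%Z}.
Proof.
move=> m_gt0 mT; pose J := {i | i \in A}.
have residue_lt (i : J) s : (`|(g (val i) s %% m (val i))%Z| < m (val i))%N.
  have mi0 := m_gt0 _ (valP i).
  by rewrite -ltz_nat gez0_abs ?ltz_pmod ?modz_ge0 // eqz_nat -lt0n.
pose residues s : {dffun forall i : J, 'I_(m (val i))} :=
  [ffun i => Ordinal (residue_lt i s)].
have /injectivePn [s [t st E]] : ~~ injectiveb residues.
  apply: contraL mT => /injectiveP residues_inj; rewrite -leqNgt.
  apply: leq_trans (leq_card _ residues_inj) _.
  rewrite card_dep_ffun foldrE big_image /= (big_sub (mem A) m).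
  by rewrite leq_eqVlt; apply/orP; left; apply/eqP/eq_bigr => i _;
    rewrite card_ord.
exists s, t; split=> // i iA; have mi0 := m_gt0 _ iA.
move/ffunP/(_ (Sub i iA)): E; rewrite !ffunE => /(congr1 val) /= /eqP.
by rewrite -eqz_nat !gez0_abs ?modz_ge0 ?eqz_nat -?lt0n // eqz_mod_dvd.
Qed.

Lemma logn_prod p (I : finType) (P : pred I) (F : I -> nat) :
    (forall i, P i -> (0 < F i)%N) ->
  logn p (\prod_(i | P i) F i)%N = (\sum_(i | P i) logn p (F i))%N.
Proof.
move=> F0; suff : (0 < \prod_(i | P i) F i)%N /\
    logn p (\prod_(i | P i) F i)%N = (\sum_(i | P i) logn p (F i))%N by case.
elim/big_rec2: _ => [|i s m /F0 Fi [m0 <-]]; first by rewrite logn1.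
by rewrite muln_gt0 Fi m0 lognM.
Qed.

Definition deg1_primes (f : {poly int}) (x : nat) : {set 'I_x.+1 * 'I_x.+1} :=
  [set a : 'I_x.+1 * 'I_x.+1 | [&& prime a.1, unramified f a.1, (a.2 < a.1)%N &
                                (val a.1 %| f.[(val a.2)%:Z])%Z]].

Definition deg1_divisors (f : {poly int}) (x : nat) (g : {poly int}) :=
  [set a in deg1_primes f x | (val a.1 %| g.[(val a.2)%:Z])%Z].

Definition set_norm (x : nat) (A : {set 'I_x.+1 * 'I_x.+1}) : nat :=
  (\prod_(a in A) a.1)%N.

Definition deg1_sets (f : {poly int}) (x Y : nat) :=
  [set A in powerset (deg1_primes f x) | (set_norm A <= Y)%N].

Section Deg1Sets.
Variables (f : {poly int}) (x : nat).
Implicit Types (g h : {poly int}) (A B : {set 'I_x.+1 * 'I_x.+1}).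

Lemma deg1_divisors_sub g : deg1_divisors f x g \subset deg1_primes f x.
Proof. by apply/subsetP => a; rewrite inE => /andP []. Qed.

Lemma sub_deg1_divisorsB A g h :
    A \subset deg1_divisors f x g -> A \subset deg1_divisors f x h ->
  A \subset deg1_divisors f x (g - h).
Proof.
move=> /subsetP Ag /subsetP Ah; apply/subsetP => a aA.
have := Ag a aA; have := Ah a aA; rewrite !inE => /andP [_ ha] /andP [-> ga].
by rewrite hornerD hornerN rpredB.
Qed.

Lemma prime_deg1 a : a \in deg1_primes f x -> prime a.1.
Proof. by rewrite inE => /and4P []. Qed.

Lemma set_norm_gt0 A : A \subset deg1_primes f x -> (0 < set_norm A)%N.
Proof.
by move=> /subsetP sA; apply: prodn_cond_gt0 => a /sA/prime_deg1/prime_gt0.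
Qed.

Lemma set_norm_setD A B :
  A \subset B -> set_norm B = (set_norm A * set_norm (B :\: A))%N.
Proof. by move=> /setIidPr AB; rewrite /set_norm (big_setID A) /= AB. Qed.

Lemma dvdn_set_norm A a : a \in A -> (a.1 %| set_norm A)%N.
Proof. by move=> aA; rewrite /set_norm (bigD1 a) //= dvdn_mulr. Qed.

Lemma logn_set_norm A p : prime p -> A \subset deg1_primes f x ->
  logn p (set_norm A) = #|[set a in A | a.1 == p :> nat]|.
Proof.
move=> pr_p /subsetP sA; rewrite logn_prod => [|a /sA/prime_deg1/prime_gt0 //].
rewrite -sum1_card; under [RHS]eq_bigl do rewrite inE; rewrite big_mkcondr /=.
apply: eq_bigr => a /sA/prime_deg1 pr_a.
by rewrite (logn_prime _ pr_a) eq_sym; case: eqP.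
Qed.

End Deg1Sets.

Definition box_vec n Z (a : {ffun 'I_n.+1 -> 'I_Z}) : 'rV[int]_n.+1 :=
  \row_i (a i : nat)%:Z.

Lemma box_vec_inj n Z : injective (@box_vec n Z).
Proof.
move=> a b /rowP E; apply/ffunP => i; apply/val_inj.
by have := E i; rewrite !mxE => -[].
Qed.

Lemma centered_box_vec_surj n (l : nat) (c : 'rV[int]_n.+1) :
    entrywise_le c l%:Z ->
  exists a : {ffun 'I_n.+1 -> 'I_(2 * l).+1}, box_vec a - const_mx l%:Z = c.
Proof.
move=> c_le; exists [ffun i => inord `|(c 0 i + l%:Z)%R|%N]; apply/rowP => i.
by rewrite !mxE ffunE; have := c_le 0 i; move: (c 0 i) => ci ?;
  rewrite inordK; lia.
Qed.

Lemma short_vector f x n (A : {set 'I_x.+1 * 'I_x.+1}) (Z : nat) :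
    A \subset deg1_primes f x -> (set_norm A < Z.+1 ^ n.+1)%N ->
  exists c : 'rV[int]_n.+1,
    [/\ c != 0, entrywise_le c Z%:Z & A \subset deg1_divisors f x (rVpoly c)].
Proof.
move=> /subsetP sA A_lt.
have [||a [b [ab cong]]] := @pigeonhole_residues _ {ffun 'I_n.+1 -> 'I_Z.+1} A
  (fun y => y.1) (fun y c => (rVpoly (box_vec c)).[(val y.2)%:Z]).
- by move=> y /sA/prime_deg1/prime_gt0.
- by rewrite card_ffun !card_ord.
exists (box_vec a - box_vec b); split.
- by rewrite subr_eq0 (inj_eq (@box_vec_inj _ _)).
- move=> i j; rewrite !mxE ler_norml.
  have := ltn_ord (a j); have := ltn_ord (b j).
  by move: (nat_of_ord (a j)) (nat_of_ord (b j)) => s t ? ?;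
    apply/andP; split; lia.
- apply/subsetP => y yA; rewrite inE sA // raddfB /= hornerD hornerN.
  exact: cong.
Qed.

Section CountUpper.
Variables (n : nat) (M : 'M[int]_n.+1).
Local Notation f := (char_poly M).
Local Notation N := (norm_form M).

Lemma set_norm_dvd_norm_form x (A : {set 'I_x.+1 * 'I_x.+1}) c :
  A \subset deg1_divisors f x (rVpoly c) -> (set_norm A %| `|N c|)%N.
Proof.
move=> /subsetP sA; have sA' : A \subset deg1_primes f x.
  by apply/subsetP => a /sA; rewrite inE => /andP [].
apply/dvdn_partP => [|p]; first exact: set_norm_gt0 sA'.
rewrite mem_primes => /and3P [pr_p _ p_norm].
rewrite p_part (logn_set_norm pr_p sA'); set Ap := [set a in A | _].
have p_unram : unramified f p.
  have : (0 < logn p (set_norm A))%N.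
    by rewrite logn_gt0 mem_primes pr_p p_norm (set_norm_gt0 sA').
  rewrite (logn_set_norm pr_p sA') => /card_gt0P [a];
    rewrite inE => /andP [aA /eqP <-].
  by have := subsetP sA' _ aA; rewrite inE => /and4P [].
rewrite cardE -(size_map (fun a => val a.2)).
apply: (pexp_nb_roots_dvd_norm_form pr_p p_unram) => [|_ /mapP [a + ->]].
  rewrite map_inj_in_uniq ?enum_uniq // => -[a1 a2] [b1 b2];
    rewrite !mem_enum !inE /=.
  move=> /andP [_ /eqP a1p] /andP [_ /eqP b1p] /val_inj ->.
  by congr (_, _); apply: val_inj; rewrite [LHS]a1p [RHS]b1p.
rewrite mem_enum inE => /andP [/sA + /eqP <-].
by rewrite !inE => /andP [/and4P [_ _ -> ->] ->].
Qed.

Lemma card_deg1_sets_of_norm_form x (c : 'rV[int]_n.+1) C :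
    irreducible_poly f -> c != 0 ->
  (#|[set A in powerset (deg1_divisors f x (rVpoly c)) |
      (`|N c| <= C * set_norm A)%N]| <= 2 ^ (C.+1 ^ 2))%N.
Proof.
move=> f_irr c0; set Ac := deg1_divisors f x (rVpoly c).
pose small := [set i : 'I_x.+1 | (i <= C)%N].
have complement_small (A : {set 'I_x.+1 * 'I_x.+1}) a : A \subset Ac ->
  (`|N c| <= C * set_norm A)%N ->
    a \in Ac :\: A -> (a.1 <= C)%N.
  move=> sA NA aD; have AcP := deg1_divisors_sub f x (rVpoly c).
  have A0 := set_norm_gt0 (subset_trans sA AcP).
  apply: leq_trans (dvdn_leq _ (dvdn_set_norm aD)) _.
    by apply/(@set_norm_gt0 f)/(subset_trans (subsetDl _ _)).
  rewrite -(leq_pmul2l A0) -(set_norm_setD sA) [X in (_ <= X)%N]mulnC.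
  apply: leq_trans NA; apply: dvdn_leq; last exact: set_norm_dvd_norm_form.
  by rewrite absz_gt0 norm_form_neq0.
apply: (@leq_trans #|powerset (setX small small)|); last first.
  rewrite card_powerset leq_exp2l // cardsX -mulnn.
  by rewrite leq_mul // card_ord_ltn // => i; rewrite inE.
rewrite -(card_in_imset (f := fun A => Ac :\: A)) => [|A B].
  apply/subset_leq_card/subsetP => _ /imsetP [A + ->].
  rewrite inE !powersetE => /andP [sA NA]; apply/subsetP => a aD.
  have a1C := complement_small A a sA NA aD; rewrite !inE a1C /=.
  move: aD; rewrite !inE => /andP [_ /andP [/and4P [_ _ lt _] _]].
  exact: leq_trans (ltnW lt) a1C.
rewrite !inE => /andP [/setIidPr sA _] /andP [/setIidPr sB _].
move/(congr1 (fun X => Ac :\: X)).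
by rewrite /= !setDDr !setDv !set0U sA sB.
Qed.

Lemma card_deg1_sets_le : irreducible_poly f ->
  exists2 K : nat, (0 < K)%N &
    forall x Y, (0 < Y)%N -> (#|deg1_sets f x Y| <= K * Y)%N.
Proof.
move=> f_irr; have [C C0 N_le] := norm_form_le M.
exists (2 ^ (C.+1 ^ 2) * 3 ^ n.+1)%N; first by rewrite muln_gt0 !expn_gt0.
move=> x Y Y0; have [l] := ex_floor_root Y (ltn0Sn n) (ltn0Sn 0).
rewrite !mul1n => /andP [lY Yl].
pose c (b : {ffun 'I_n.+1 -> 'I_(2 * l).+1}) := box_vec b - const_mx l%:Z.
pose fiber b := [set A in powerset (deg1_divisors f x (rVpoly (c b))) |
  (c b != 0) && (`|N (c b)| <= C * set_norm A)%N].
have fiber_le b : b \in setT -> (#|fiber b| <= 2 ^ (C.+1 ^ 2))%N.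
  move=> _; have [c0|c0] := eqVneq (c b) 0.
    by rewrite /fiber c0 eqxx (_ : [set _ in _ | _] = set0) ?cards0 //;
      apply/setP => A; rewrite !inE andbF.
  apply: leq_trans (card_deg1_sets_of_norm_form x C f_irr c0).
  by apply/subset_leq_card/subsetP => A; rewrite !inE => /and3P [-> _].
apply: leq_trans (card_le_fibers _ fiber_le) _ => [A|].
  rewrite inE powersetE => /andP [sA AY].
  have [m] := ex_floor_root (set_norm A) (ltn0Sn n) (ltn0Sn 0).
  rewrite !mul1n => /andP [mA Am];
    have [a [a0 a_le a_div]] := short_vector sA Am.
  have ml : (m <= l)%N.
    by rewrite -ltnS -(@ltn_exp2r _ _ n.+1) // (leq_ltn_trans mA) //
      (leq_ltn_trans AY).
  have [|b bE] := @centered_box_vec_surj n l a.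
    by move=> i j; apply: le_trans (a_le i j) _.
  exists b; rewrite // inE powersetE /c bE a_div a0 /=.
  by apply: leq_trans (N_le _ _ a_le) _; rewrite leq_mul2l mA orbT.
rewrite cardsT card_ffun !card_ord -mulnA leq_mul2l; apply/orP; right.
apply: (@leq_trans (3 ^ n.+1 * l ^ n.+1)%N); last by rewrite leq_mul2l lY orbT.
rewrite -expnMn leq_exp2r //; case: l Yl {c fiber fiber_le lY} => [|l _];
  last by lia.
by rewrite exp1n ltnS leqNgt Y0.
Qed.

End CountUpper.

(** * Lower bound for the number of sets of small norm *)

Lemma sum_inv_sq_le (F : realFieldType) y m : (0 < y)%N ->
  \sum_(y.+1 <= i < m) (i%:R ^- 2 : F) <= y%:R^-1.
Proof.
move=> y0; have [my|ym] := leqP m y.+1; first by rewrite big_geq ?invr_ge0.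
rewrite big_add1; set m' := m.-1; have ym' : (y <= m')%N.
  by rewrite -ltnS prednK ?(ltn_trans _ ym).
apply: (@le_trans _ _ (\sum_(y <= i < m') (- i.+1%:R^-1 - - i%:R^-1))).
  apply: ler_sum_nat => i /andP [yi _].
  have i0 : 0 < i%:R :> F by rewrite ltr0n (leq_trans y0).
  rewrite -natr1; move: (i%:R : F) i0 => r r0.
  rewrite -subr_ge0 (_ : _ - _ = (r * (r + 1) ^+ 2)^-1); last by field; lra.
  by rewrite invr_ge0 mulr_ge0 ?exprn_ge0 //; lra.
rewrite (telescope_sumr (fun i => - (i%:R : F)^-1)) //.
by rewrite opprK gerDr oppr_le0 invr_ge0.
Qed.

Lemma leq_expS (a d : nat) : (a.+1 ^ d <= 2 ^ d * (1 + a ^ d))%N.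
Proof.
case: a => [|a]; first by rewrite exp1n muln_gt0 expn_gt0.
apply: (@leq_trans (2 ^ d * a.+1 ^ d)%N);
  last by rewrite leq_mul2l leq_addl orbT.
by rewrite -expnMn; case: d => [|d] //; rewrite leq_exp2r //; lia.
Qed.

Definition squarefree (m : nat) : bool :=
  all (fun q => ~~ (q ^ 2 %| m)%N) (primes m).

Lemma squarefree_dvdn (m k : nat) : (0 < m)%N -> squarefree m ->
  (forall q, prime q -> (q %| m)%N -> (q %| k)%N) -> (m %| k)%N.
Proof.
move=> m0 /allP sqf_m dvd_k; apply/dvdn_partP => // q q_m.
have := q_m; rewrite mem_primes => /and3P [pr_q _ qm]; rewrite p_part.
suff -> : logn q m = 1%N by rewrite expn1 dvd_k.
apply/eqP; rewrite eqn_leq logn_gt0 q_m andbT leqNgt.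
by apply: contra (sqf_m q q_m) => lt1; rewrite (pfactor_dvdn _ pr_q).
Qed.

Lemma prime_ndvd_fact q y : prime q -> (y < q)%N -> ~~ (q %| y`!)%N.
Proof.
move=> pr_q yq; apply/negP;
  rewrite fact_prod Euclid_dvd_prod // big_has => /hasP [i].
by rewrite mem_index_iota => /andP [i1 iy] /dvdn_leq => /(_ i1); lia.
Qed.

Section ShiftedBox.
Variables (n : nat) (M : 'M[int]_n.+1).
Local Notation f := (char_poly M).
Local Notation N := (norm_form M).

(* When t = 1 and p = 0 modulo the small primes, the norm form is prime to them on
   these vectors; a large t keeps it away from 0. *)
Definition shifted_vec (t p Z : nat)
    (a : {ffun 'I_n.+1 -> 'I_Z}) : 'rV[int]_n.+1 :=
  t%:Z *: delta_mx 0 0 + p%:Z *: box_vec a.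

Lemma horner_mx_shifted_vec t p Z (a : {ffun 'I_n.+1 -> 'I_Z}) :
  horner_mx M (rVpoly (shifted_vec t p a)) =
  t%:Z%:M + p%:Z *: horner_mx M (rVpoly (box_vec a)).
Proof.
rewrite /shifted_vec linearD /= rmorphD /= !linearZ /=.
by rewrite rVpoly_delta expr0 rmorph1 scalemx1.
Qed.

Lemma shifted_vecB t p Z (a b : {ffun 'I_n.+1 -> 'I_Z}) :
  shifted_vec t p a - shifted_vec t p b = p%:Z *: (box_vec a - box_vec b).
Proof. by rewrite /shifted_vec opprD addrACA subrr add0r -scalerBr. Qed.

Lemma box_vec_entrywise_le Z (a : {ffun 'I_n.+1 -> 'I_Z}) :
  entrywise_le (box_vec a) Z%:Z.
Proof. by move=> i j; rewrite mxE ger0_norm // lez_nat ltnW. Qed.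

Lemma shifted_vec_entrywise_le t p Z (a : {ffun 'I_n.+1 -> 'I_Z}) :
  entrywise_le (shifted_vec t p a) (t + p * Z)%N%:Z.
Proof.
move=> i j; rewrite mxE PoszD; apply: le_trans (ler_normD _ _) (lerD _ _).
  by rewrite !mxE normrM; case: (_ && _); rewrite ?normr1 ?mulr1 ?normr0 ?mulr0.
by rewrite mxE normrM PoszM ler_wpM2l // box_vec_entrywise_le.
Qed.

Lemma norm_form_shifted_vec_coprime t p q Z (a : {ffun 'I_n.+1 -> 'I_Z}) :
  prime q -> (q %| p)%N -> (q %| t)%N ->
  ~~ (q %| `|N (shifted_vec t.+1 p a)|)%N.
Proof.
move=> pr_q qp qt; have qF := pchar_Fp pr_q.
have natF0 k : (q %| k)%N -> (k%:Z)%:~R = 0 :> 'F_q.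
  by move=> qk; apply/eqP; rewrite -(dvdz_pcharf qF).
rewrite -[(q %| _)%N]/(q%:Z %| N (shifted_vec t.+1 p a))%Z (dvdz_pcharf qF).
rewrite -det_map_mx horner_mx_shifted_vec map_mxD map_scalar_mx map_mxZ /=.
by rewrite (natF0 p qp) intS rmorphD /= (natF0 t qt) addr0 scale0r addr0
  det1 oner_eq0.
Qed.

Lemma norm_form_shifted_vec_ge : exists2 H : nat, (0 < H)%N &
  forall t p Z (a : {ffun 'I_n.+1 -> 'I_Z}),
    (0 < p)%N -> (H * p * Z <= t)%N -> (Z ^ n.+1)%N%:Z <= N (shifted_vec t p a).
Proof.
have [E E0 entries_le] := horner_mx_entrywise_le M.
exists ((2 + n.+1`! * 2 ^ n) * `|E|.+1)%N => // t p Z a p0 t_large.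
have Z_le : (Z ^ n.+1)%N%:Z <= (p%:Z * (`|E|.+1%:Z * Z%:Z)) ^+ n.+1.
  rewrite -natrXE rmorphXn /= lerXn2r ?nnegrE // -!PoszM lez_nat mulnA.
  by rewrite leq_pmull // muln_gt0 p0.
apply: le_trans Z_le _; rewrite /norm_form horner_mx_shifted_vec.
apply: det_scalar_add_ge; last by rewrite !natz -!(PoszD, PoszM) lez_nat; lia.
move=> i j; rewrite mxE normrM ler_wpM2l //.
apply: le_trans (entries_le _ _ (box_vec_entrywise_le a) i j) _.
by rewrite ler_wpM2r // -[X in X <= _](gez0_abs E0) lez_nat.
Qed.

End ShiftedBox.

Section CountLower.
Variables (n : nat) (M : 'M[int]_n.+1).
Local Notation f := (char_poly M).
Local Notation N := (norm_form M).
Local Notation d := n.+1.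
Hypothesis f_irr : irreducible_poly f.
Variable C : nat.
Hypothesis C_gt0 : (0 < C)%N.
Hypothesis N_le : forall (c : 'rV[int]_d) (Z : nat),
  entrywise_le c Z%:Z -> (`|N c| <= C * Z ^ d)%N.

(* Two points of W in the same cell of side l + 1, where C * l ^ d < m, differ by a
   vector whose norm form is smaller than m. *)
Lemma packing Z (W : {set {ffun 'I_d -> 'I_Z}}) m : (0 < m)%N ->
    {in W &, forall a b, (m %| `|N (box_vec a - box_vec b)|)%N} ->
  (#|W| * m <= 2 ^ d * (m + C * Z ^ d))%N.
Proof.
move=> m0 m_dvd; have [l /andP []] := ex_floor_root m.-1 (ltn0Sn n) C_gt0.
rewrite -ltnS prednK // => lm ml.
have dist_lt (s t : nat) : (s %/ l.+1 = t %/ l.+1)%N -> `|s%:Z - t%:Z| <= l%:Z.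
  move=> st; have := divn_eq s l.+1; have := divn_eq t l.+1; rewrite st.
  have := ltn_pmod s (ltn0Sn l); have := ltn_pmod t (ltn0Sn l).
  by move: (s %% l.+1)%N (t %% l.+1)%N (t %/ l.+1 * l.+1)%N => *; lia.
pose cell (a : {ffun 'I_d -> 'I_Z}) : {ffun 'I_d -> 'I_(Z %/ l.+1).+1} :=
  [ffun i => inord (a i %/ l.+1)].
have W_le : (#|W| <= (Z %/ l.+1).+1 ^ d)%N.
  rewrite -(card_in_imset (f := cell)) => [|a b aW bW /ffunP same_cell].
    by apply: leq_trans (max_card _) _; rewrite card_ffun !card_ord.
  apply/eqP/negPn/negP => ab.
  have : (`|N (box_vec a - box_vec b)| <= C * l ^ d)%N.
    apply: N_le => i j; rewrite !mxE; apply: dist_lt.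
    have div_lt (k : 'I_Z) : (k %/ l.+1 < (Z %/ l.+1).+1)%N.
      by rewrite ltnS leq_div2r // ltnW.
    by have := congr1 val (same_cell j); rewrite !ffunE /= !inordK.
  rewrite leqNgt => /negP; apply; apply: leq_trans lm _.
  apply: dvdn_leq (m_dvd _ _ aW bW).
  by rewrite absz_gt0 norm_form_neq0 // subr_eq0 (inj_eq (@box_vec_inj _ _)).
apply: (@leq_trans (2 ^ d * (1 + (Z %/ l.+1) ^ d) * m)%N).
  by rewrite leq_mul2r (leq_trans W_le) ?orbT // leq_expS.
rewrite -mulnA leq_mul2l; apply/orP; right; rewrite mulnDl mul1n leq_add2l.
apply: (@leq_trans ((Z %/ l.+1) ^ d * (C * l.+1 ^ d))%N);
  first by rewrite leq_mul2l ml orbT.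
by rewrite mulnCA -expnMn leq_mul2l leq_exp2r // leq_divM orbT.
Qed.

Lemma card_sq_dvd_norm_form_le (t p Z q : nat) :
    prime q -> unramified f q -> ~~ (q %| p)%N ->
  (#|[set a : {ffun 'I_d -> 'I_Z} | q ^ 2 %| `|N (shifted_vec t p a)|]| * q ^ 2
    <= d ^ 2 * 2 ^ d * (q ^ 2 + C * Z ^ d))%N.
Proof.
move=> pr_q q_unram qp;
  have [L [P [z [qL uP _ PM]]]] := diagonalize_mod_p pr_q q_unram.
pose W ij := [set a : {ffun 'I_d -> 'I_Z} |
  `[< square_lattice M q z ij (shifted_vec t p a) >]].
have q2 : (0 < q ^ 2)%N by rewrite expn_gt0 prime_gt0.
have W_le ij : ij \in [set: 'I_d * 'I_d] ->
    (#|W ij| <= (2 ^ d * (q ^ 2 + C * Z ^ d)) %/ q ^ 2)%N.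
  move=> _; rewrite leq_divRL //; apply: packing => // a b;
    rewrite !inE => /asboolP a_lat /asboolP b_lat.
  apply: (dvd_norm_form_square_lattice pr_q qL uP PM (ij := ij)).
  apply: (square_latticeZ pr_q qL (m := p%:Z)) => //; rewrite -(shifted_vecB t).
  exact: (square_latticeB pr_q q_unram qL).
have := card_le_fibers (fiber := W) _ W_le;
  rewrite cardsT card_prod card_ord mulnn => card_le.
apply: (@leq_trans ((2 ^ d * (q ^ 2 + C * Z ^ d)) %/ q ^ 2 * d ^ 2 * q ^ 2)%N).
  rewrite leq_mul2r; apply/orP; right; apply: card_le => a; rewrite inE => q2N.
  have [ij] := square_lattice_of_dvd_norm_form qL uP PM q2N.
  by exists ij; rewrite // inE; apply/asboolP.
rewrite mulnAC [X in (X <= _)%N]mulnC -[X in (_ <= X)%N]mulnA leq_mul2l.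
by rewrite leq_divM orbT.
Qed.

Lemma set_norm_deg1_divisors x (c : 'rV[int]_d) :
    (0 < `|N c| <= x)%N -> squarefree `|N c| ->
    (forall q, prime q -> (q %| `|N c|)%N -> unramified f q) ->
  set_norm (deg1_divisors f x (rVpoly c)) = `|N c|%N.
Proof.
move=> /andP [N0 Nx] sqf unram; apply/eqP;
  rewrite eqn_dvd set_norm_dvd_norm_form //=.
apply: squarefree_dvdn => // q pr_q qN; have q_unram := unram q pr_q qN.
have sq_ndvd : ~~ (q ^ 2 %| `|N c|)%N.
  by move/allP: sqf; apply; rewrite mem_primes pr_q N0.
have [r /and3P [rq fr cr]] := residue_root_of_dvd_norm_form pr_q qN sq_ndvd.
have qx : (q < x.+1)%N by rewrite ltnS (leq_trans (dvdn_leq N0 qN)).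
have rx : (r < x.+1)%N by apply: leq_trans rq (ltnW qx).
apply: (@dvdn_set_norm _ _ (Ordinal qx, Ordinal rx)).
by rewrite !inE /= pr_q q_unram rq fr cr.
Qed.

Section SievedBox.
Variables (y w U Z : nat).
Local Notation c :=
  (fun a : {ffun 'I_d -> 'I_Z} => shifted_vec (y`! * w).+1 y`! a).
Local Notation K := (d ^ 2 * 2 ^ d)%N.
Hypothesis unram_above : forall q, prime q -> (y < q)%N -> unramified f q.
Hypothesis N_ge : forall a, (Z ^ d <= `|N (c a)|)%N.
Hypothesis N_le_U : forall a, (`|N (c a)| <= U * Z ^ d)%N.
Hypotheses (y_large : (4 * K * C <= y)%N) (y_gt0 : (0 < y)%N).
Hypotheses (Z_gt0 : (0 < Z)%N) (Z_large : (16 * K ^ 2 * U <= Z ^ d)%N).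

Lemma norm_form_box_gt0 a : (0 < `|N (c a)|)%N.
Proof. by apply: leq_trans (N_ge a); rewrite expn_gt0 Z_gt0. Qed.

Lemma prime_dvd_norm_form_box a q : prime q -> (q %| `|N (c a)|)%N -> (y < q)%N.
Proof.
move=> pr_q; apply: contraLR; rewrite -leqNgt => qy.
have q_fact : (q %| y`!)%N by rewrite dvdn_fact // prime_gt0.
by apply: norm_form_shifted_vec_coprime; rewrite ?dvdn_mulr.
Qed.

Definition sq_dvd_set s :=
  \bigcup_(q < s.+1 | prime q && (y < q)%N) [set a | (q ^ 2 %| `|N (c a)|)%N].

Lemma card_sq_dvd_set_le s :
  (#|sq_dvd_set s|%:R : rat) <= K%:R * s%:R + K%:R * (C * Z ^ d)%N%:R * y%:R^-1.
Proof.
pose sq_dvd (q : nat) := [set a | (q ^ 2 %| `|N (c a)|)%N].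
have sq_dvd_le (q : 'I_s.+1) : prime q && (y < q)%N ->
    (#|sq_dvd q|%:R : rat) <= K%:R + K%:R * (C * Z ^ d)%N%:R * q%:R ^- 2.
  move=> /andP [pr_q yq]; have q0 : 0 < q%:R ^+ 2 :> rat.
    by rewrite exprn_gt0 // ltr0n prime_gt0.
  have := card_sq_dvd_norm_form_le (y`! * w).+1 Z pr_q (unram_above pr_q yq)
    (prime_ndvd_fact pr_q yq).
  rewrite -(ler_nat rat) natrM [X in _ <= X]natrM natrD !natrX => card_le.
  by rewrite -(ler_pM2r q0) [X in _ <= X]mulrDl mulfVK ?gt_eqF // -mulrDr.
apply: (@le_trans _ _
  (\sum_(q < s.+1 | prime q && (y < q)%N) #|sq_dvd q|)%N%:R).
  by rewrite ler_nat card_big_setU.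
rewrite natr_sum; apply: le_trans (ler_sum _ sq_dvd_le) _.
rewrite big_split /=; apply: lerD.
  rewrite sumr_const -[X in X <= _]mulr_natr ler_wpM2l // ler_nat.
  rewrite -[X in (_ <= X)%N]/(s.+1.-1) -[X in (_ <= X.-1)%N]card_ord
    -(cardC1 ord0).
  apply/subset_leq_card/subsetP => q; rewrite !inE => /andP [_ yq].
  by rewrite -val_eqE /= -lt0n (leq_trans _ yq).
rewrite -mulr_sumr ler_wpM2l ?mulr_ge0 //;
  apply: le_trans (sum_inv_sq_le rat s.+1 y_gt0).
rewrite big_geq_mkord /= [X in X <= _]big_mkcond [X in _ <= X]big_mkcond /=.
apply: ler_sum => q _; case: (prime q); case: (y < q)%N => //=.
by rewrite invr_ge0 exprn_ge0.
Qed.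

Lemma card_squarefree_box : (Z ^ d <= 2 * #|[set a | squarefree `|N (c a)|]|)%N.
Proof.
have [s] := ex_floor_root (U * Z ^ d) (isT : (0 < 2)%N) (ltn0Sn 0).
rewrite !mul1n => /andP [s_le lt_s].
have s_small : (4 * K * s <= Z ^ d)%N.
  rewrite -(@leq_exp2r _ _ 2) // expnMn;
    apply: (@leq_trans ((4 * K) ^ 2 * (U * Z ^ d))%N).
    by rewrite leq_mul2l s_le orbT.
  by rewrite mulnA expnMn -[X in (_ <= X)%N]mulnn leq_mul2r Z_large orbT.
have few_sq_dvd : (2 * #|sq_dvd_set s| <= Z ^ d)%N.
  rewrite -(ler_nat rat) natrM.
  have y0 : 0 < y%:R :> rat by rewrite ltr0n.
  have main_le : 4 * (K%:R * s%:R) <= (Z ^ d)%N%:R :> rat.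
    by rewrite mulrA -!natrM ler_nat.
  have tail_le : 4 * (K%:R * (C * Z ^ d)%N%:R * y%:R^-1) <= (Z ^ d)%N%:R :> rat.
    rewrite mulrA ler_pdivrMr // -!natrM ler_nat.
    by rewrite [X in (_ <= X)%N]mulnC (mulnA K) (mulnA 4) leq_mul2r mulnA
      y_large orbT.
  by have := card_sq_dvd_set_le s; lra.
have squarefree_of_notin :
    ~: sq_dvd_set s \subset [set a | squarefree `|N (c a)|].
  apply/subsetP => a; rewrite !inE; apply: contraR => /allPn [q].
  rewrite mem_primes negbK => /and3P [pr_q N0 qN] q2N.
  have qs : (q < s.+1)%N.
    rewrite -(@ltn_exp2r _ _ 2) //; apply: leq_ltn_trans (dvdn_leq N0 q2N) _.
    exact: leq_ltn_trans (N_le_U a) lt_s.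
  apply/bigcupP; exists (Ordinal qs); last by rewrite inE.
  by rewrite /= pr_q (prime_dvd_norm_form_box pr_q qN).
have := subset_leq_card squarefree_of_notin; have := cardsC (sq_dvd_set s).
rewrite card_ffun !card_ord; move: few_sq_dvd; lia.
Qed.

Lemma card_same_deg1_divisors x A : (U * Z ^ d <= x)%N ->
  (#|[set a | squarefree `|N (c a)| & deg1_divisors f x (rVpoly (c a)) == A]| <=
   2 ^ d * (1 + C))%N.
Proof.
move=> Ux; set W := [set a | _ & _]; have [->|[a0 a0W]] := set_0Vmem W;
  first by rewrite cards0.
have norm_A a : a \in W -> set_norm A = `|N (c a)|%N.
  rewrite inE => /andP [sqf /eqP <-]; apply: set_norm_deg1_divisors => //.
    by rewrite norm_form_box_gt0 (leq_trans (N_le_U a)).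
  by move=> q pr_q qN; apply/unram_above/(prime_dvd_norm_form_box pr_q qN).
have A_ge : (Z ^ d <= set_norm A)%N by rewrite (norm_A a0).
have A_gt0 : (0 < set_norm A)%N.
  by apply: leq_trans A_ge; rewrite expn_gt0 Z_gt0.
have A_div a : a \in W -> A \subset deg1_divisors f x (rVpoly (c a)).
  by rewrite inE => /andP [_ /eqP ->].
rewrite -(leq_pmul2r A_gt0);
  apply: leq_trans (packing A_gt0 _) _ => [a b aW bW|].
  apply: set_norm_dvd_norm_form (_ : _ \subset deg1_divisors f x _).
  apply/subsetP => e eA;
    have := subsetP (sub_deg1_divisorsB (A_div a aW) (A_div b bW)) e eA.
  rewrite -raddfB /= shifted_vecB !inE linearZ /= hornerZ => /andP [e_deg1].
  have [pr_e] : prime e.1 /\ (e.1 %| `|N (c a)|)%N.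
    by rewrite -(norm_A a aW) dvdn_set_norm //; case/and4P: e_deg1.
  move/(prime_dvd_norm_form_box pr_e) => ye; rewrite e_deg1 Gauss_dvdzr //.
  by rewrite coprimezE prime_coprime // prime_ndvd_fact.
by rewrite -mulnA leq_mul2l mulnDl mul1n leq_add2l leq_mul2l A_ge !orbT.
Qed.

Lemma card_deg1_sets_box_ge x Y : (U * Z ^ d <= Y <= x)%N ->
  (Z ^ d <= 2 * (2 ^ d * (1 + C)) * #|deg1_sets f x Y|)%N.
Proof.
move=> /andP [UY Yx]; apply: leq_trans card_squarefree_box _.
rewrite -mulnA leq_mul2l; pose fiber A :=
  [set a | squarefree `|N (c a)| & deg1_divisors f x (rVpoly (c a)) == A].
apply: (card_le_fibers (fiber := fiber)) => [a|A _]; last first.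
  exact: card_same_deg1_divisors (leq_trans UY Yx).
rewrite inE => sqf; exists (deg1_divisors f x (rVpoly (c a)));
  rewrite inE ?sqf ?eqxx //.
rewrite powersetE deg1_divisors_sub /= (leq_trans _ UY) //.
apply: leq_trans (dvdn_leq (norm_form_box_gt0 a) _) (N_le_U a).
exact: set_norm_dvd_norm_form.
Qed.

End SievedBox.
End CountLower.

Lemma card_deg1_sets_cube_ge n (M : 'M[int]_n.+1) :
    irreducible_poly (char_poly M) ->
  exists U K Zmin : nat, [/\ (0 < U)%N, (0 < K)%N & forall x Y Z,
    (0 < Z)%N -> (Zmin <= Z ^ n.+1)%N -> (U * Z ^ n.+1 <= Y <= x)%N ->
    (Z ^ n.+1 <= K * #|deg1_sets (char_poly M) x Y|)%N].
Proof.
move=> f_irr; have [C C_gt0 N_le] := norm_form_le M.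
have [H H_gt0 N_ge] := norm_form_shifted_vec_ge M.
pose K1 := (n.+1 ^ 2 * 2 ^ n.+1)%N.
have [y y_large unram] : exists2 y, (4 * K1 * C < y)%N &
    forall q, prime q -> (y < q)%N -> unramified (char_poly M) q.
  have [B unram] := ex_unramified_above (char_poly_monic M) f_irr.
  exists (4 * K1 * C + B).+1 => [|q pr_q Bq]; first by rewrite ltnS leq_addr.
  by apply: unram => //; apply: leq_ltn_trans Bq; rewrite leqW ?leq_addl.
pose U := (C * (1 + H * y`! + y`!) ^ n.+1)%N.
exists U, (2 * (2 ^ n.+1 * (1 + C)))%N, (16 * K1 ^ 2 * U)%N; split.
- by rewrite muln_gt0 C_gt0 expn_gt0.
- by rewrite !muln_gt0 expn_gt0.
move=> x Y Z Z_gt0 Z_large.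
apply: (card_deg1_sets_box_ge f_irr C_gt0 N_le (w := (H * Z)%N) unram) => //.
- move=> a; rewrite -lez_nat abszE; apply: le_trans (ler_norm _).
  by apply: N_ge; rewrite ?fact_gt0 // mulnAC mulnC leqW.
- move=> a; rewrite /U -mulnA -expnMn.
  apply: leq_trans (N_le _ _ (shifted_vec_entrywise_le _ _ a)) _.
  rewrite leq_mul2l leq_exp2r //; apply/orP; right.
  by rewrite !mulnDl mul1n mulnCA mulnA -add1n !leq_add2r.
- exact: ltnW.
- exact: leq_ltn_trans y_large.
Qed.

Lemma card_deg1_sets_ge n (M : 'M[int]_n.+1) : irreducible_poly (char_poly M) ->
  exists K Y0 : nat, (0 < K)%N /\ forall x Y, (Y0 <= Y <= x)%N ->
    (Y <= K * #|deg1_sets (char_poly M) x Y|)%N.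
Proof.
move=> /card_deg1_sets_cube_ge [U [K [Zmin [U_gt0 K_gt0 cube_ge]]]].
exists (U * (2 ^ n.+1 * 2) * K)%N, (U * (2 ^ n.+1 * (1 + Zmin.+1)))%N; split.
  by rewrite !muln_gt0 U_gt0 expn_gt0.
move=> x Y /andP [Y_large Yx];
  have [Z /andP [UZ YU]] := ex_floor_root Y (ltn0Sn n) U_gt0.
have Y_le : (Y < U * (2 ^ n.+1 * (1 + Z ^ n.+1)))%N.
  by apply: leq_trans YU _; rewrite leq_mul2l leq_expS orbT.
have Z_large : (Zmin.+1 < Z ^ n.+1)%N.
  rewrite -(ltn_add2l 1) -(@ltn_pmul2l (2 ^ n.+1)) ?expn_gt0 //
    -(@ltn_pmul2l U) //.
  exact: leq_ltn_trans Y_large Y_le.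
have Z_gt0 : (0 < Z)%N by case: Z Z_large {UZ YU Y_le}; rewrite ?exp0n.
have cube_le :=
  cube_ge x Y Z Z_gt0 (ltnW (ltnW Z_large)) (introT andP (conj UZ Yx)).
apply: leq_trans (ltnW Y_le) _; rewrite -!mulnA !leq_mul2l; apply/orP; right.
apply/orP; right; apply: (@leq_trans (2 * Z ^ n.+1)%N);
  last by rewrite leq_mul2l cube_le.
by rewrite mul2n -addnn leq_add2r (leq_trans _ Z_large).
Qed.

(** * Weighted sums over sets of bounded norm *)

Lemma sum_geometric_le (F : realFieldType) (r : F) J : 0 <= r < 1 ->
  \sum_(j < J) r ^+ j <= (1 - r)^-1.
Proof.
move=> /andP [r0 r1]; rewrite -[leRHS]mul1r ler_pdivlMr ?subr_gt0 // mulrC.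
by rewrite -opprB mulNr -subrX1 opprB lerBlDr lerDl exprn_ge0.
Qed.

Lemma harmonic_ge_ln (R : realType) m n : (m <= n)%N ->
  ln (n.+1%:R : R) - ln (m.+1%:R : R) <= \sum_(m <= Y < n) Y.+1%:R^-1.
Proof.
move=> mn; rewrite -(telescope_sumr (fun Y => ln (Y.+1%:R : R))) //.
apply: ler_sum_nat => Y _; have Y0 : 0 < Y.+1%:R :> R by rewrite ltr0n.
rewrite -ln_div ?posrE ?ltr0n // -natr1 mulrDl mulfV ?gt_eqF // mul1r.
by apply: le_ln1Dx; apply: lt_trans (_ : -1 < 0) _; rewrite ?ltrN10 ?invr_gt0.
Qed.

Section PartialSummation.
Variables (F : realFieldType) (T : finType) (S : {set T}) (nu : T -> nat).
Hypothesis nu_gt0 : {in S, forall A, (0 < nu A)%N}.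

Lemma sum_card_le_sum_inv Y0 x : (0 < Y0)%N ->
  \sum_(Y0 <= Y < x) #|[set A in S | (nu A <= Y)%N]|%:R * (Y%:R^-1 - Y.+1%:R^-1)
    <= \sum_(A in S | (nu A <= x)%N) (nu A)%:R^-1 :> F.
Proof.
move=> Y0_gt0; pose gap (Y : nat) : F := Y%:R^-1 - Y.+1%:R^-1.
have gap_ge0 Y : (0 < Y)%N -> 0 <= gap Y.
  by move=> Y_gt0; rewrite subr_ge0 lef_pV2 ?posrE ?ltr0n // ler_nat.
have card_sum Y : #|[set A in S | (nu A <= Y)%N]|%:R
  = \sum_(A in S) (nu A <= Y)%N%:R :> F.
  rewrite -natr_sum -big_mkcondr /= sum1_card; congr (_%:R).
  by apply: eq_card => A; rewrite inE.
under eq_bigr => Y _ do rewrite card_sum mulr_suml.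
rewrite exchange_big [leRHS]big_mkcondr /=; apply: ler_sum => A AS.
have [nux|xnu] := leqP (nu A) x; last first.
  rewrite big_nat big1 // => Y /andP [_ Yx].
  by rewrite leqNgt (ltn_trans Yx xnu) mul0r.
apply: (@le_trans _ _ (\sum_(nu A <= Y < x) gap Y)).
  rewrite !big_geq_mkord [leLHS]big_mkcond [leRHS]big_mkcond /=.
  apply: ler_sum => Y _; case: (leqP (nu A) Y) => [nuY|_].
    by rewrite mul1r; case: ifP => // _;
      apply: gap_ge0 (leq_trans (nu_gt0 AS) nuY).
  by rewrite mul0r; case: ifP.
rewrite (eq_bigr (fun Y : nat => - Y.+1%:R^-1 - - Y%:R^-1)) => [|Y _];
  last first.
  by rewrite opprK addrC.
rewrite (telescope_sumr (fun Y : nat => - (Y%:R : F)^-1)) // opprK.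
by rewrite gerDr oppr_le0 invr_ge0.
Qed.

End PartialSummation.

Definition mertens_weight (R : realType) (x n : nat) : R :=
  n%:R `^ (- (1 + (ln x%:R)^-1)).

Section MertensWeight.
Variables (R : realType) (x : nat).
Local Notation wt := (mertens_weight R x).

Lemma mertens_weight_ge0 n : 0 <= wt n.
Proof. exact: powR_ge0. Qed.

Lemma mertens_weight1 : wt 1 = 1.
Proof. by rewrite /mertens_weight powR1. Qed.

Lemma mertens_weightM m n : wt (m * n) = wt m * wt n.
Proof. by rewrite /mertens_weight natrM powRM. Qed.

Lemma mertens_weight_prod (I : finType) (A : {set I}) (F : I -> nat) :
  wt (\prod_(i in A) F i)%N = \prod_(i in A) wt (F i).
Proof. exact: (big_morph wt mertens_weightM mertens_weight1). Qed.

Lemma mertens_weightX m n : wt (m ^ n) = wt m ^+ n.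
Proof.
by elim: n => [|n IH];
  rewrite ?mertens_weight1 // expnS mertens_weightM IH exprS.
Qed.

Hypothesis ln_x : 1 <= ln (x%:R : R).

Let ln_x_gt0 : 0 < ln (x%:R : R) := lt_le_trans ltr01 ln_x.

Lemma mertens_weight_le m n : (0 < m <= n)%N -> wt n <= wt m.
Proof.
move=> /andP [m0 mn]; have n0 := leq_trans m0 mn.
rewrite /mertens_weight !powRN lef_pV2 ?posrE ?powR_gt0 ?ltr0n //.
by apply: ge0_ler_powR; rewrite ?nnegrE ?ler_nat // addr_ge0 // invr_ge0 ltW.
Qed.

Lemma mertens_weight_le_inv n : (0 < n)%N -> wt n <= n%:R^-1.
Proof.
move=> n0; rewrite /mertens_weight powRN lef_pV2 ?posrE ?powR_gt0 ?ltr0n //.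
by apply: le1r_powR; rewrite ?ler1n // lerDl invr_ge0 ltW.
Qed.

Lemma mertens_weight_le1 n : (0 < n)%N -> wt n <= 1.
Proof. by move=> n0; rewrite -mertens_weight1 mertens_weight_le. Qed.

Lemma mertens_weight_ge_inv n : (0 < n <= x)%N -> expR (-1) / n%:R <= wt n.
Proof.
move=> /andP [n0 nx]; have nR : 0 < n%:R :> R by rewrite ltr0n.
rewrite /mertens_weight opprD powRD; last by rewrite (gt_eqF nR) implybT.
rewrite powR_inv1 ?ler0n // mulrC ler_pM2l ?invr_gt0 //.
rewrite /powR gt_eqF // ler_expR mulNr lerN2 mulrC ler_pdivrMr ?mul1r //.
by rewrite ler_ln ?posrE ?ler_nat // ltr0n (leq_trans n0).
Qed.

Lemma sum_geometric_mertens_weight2 J :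
  \sum_(j < J) (2 * wt 2) ^+ j <= (1 + (ln 2)^-1) * ln (x%:R : R).
Proof.
have ln2 : 0 < ln (2 : R) by rewrite ln_gt0 // ltr1n.
set y := ln 2 / ln (x%:R : R); have y0 : 0 < y by rewrite divr_gt0.
have -> : 2 * wt 2 = expR (- y).
  rewrite /mertens_weight opprD powRD ?pnatr_eq0 ?implybT // powR_inv1 //.
  by rewrite mulrA mulfV ?pnatr_eq0 // mul1r /powR pnatr_eq0 /= mulNr mulrC.
have r_le : expR (- y) <= (1 + y)^-1.
  by rewrite expRN lef_pV2 ?posrE ?expR_gt0 ?expR_ge1Dx //; lra.
apply: le_trans (sum_geometric_le _ _) _;
  first by rewrite expR_ge0 expR_lt1 oppr_lt0.
apply: (@le_trans _ _ (1 + y^-1)); last first.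
  by rewrite invf_div mulrDl mul1r lerD // mulrC.
have -> : 1 + y^-1 = (1 - (1 + y)^-1)^-1 by field; lra.
rewrite lef_pV2 ?posrE ?subr_gt0 ?invf_lt1 ?expR_lt1 ?oppr_lt0 //; lra.
Qed.

Section SumOverSets.
Variables (T : finType) (S : {set T}) (nu : T -> nat) (K : nat).
Hypothesis nu_gt0 : {in S, forall A, (0 < nu A)%N}.

Lemma sum_mertens_weight_le :
    (forall Y, (0 < Y)%N -> (#|[set A in S | (nu A <= Y)%N]| <= K * Y)%N) ->
  \sum_(A in S) wt (nu A) <= 2 * K%:R * (1 + (ln 2)^-1) * ln (x%:R : R).
Proof.
move=> card_le; pose J := (\max_(A in S) trunc_log 2 (nu A)).+1.
have log_bounds A : A \in S ->
  (2 ^ trunc_log 2 (nu A) <= nu A < 2 ^ (trunc_log 2 (nu A)).+1)%N.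
  by move=> /nu_gt0; apply: trunc_log_bounds.
have log_lt A : A \in S -> (trunc_log 2 (nu A) < J)%N.
  by move=> AS;
    rewrite ltnS (leq_bigmax_cond (F := fun A => trunc_log 2 (nu A))).
apply: (@le_trans _ _
  (\sum_(A in S) \sum_(j < J | trunc_log 2 (nu A) == j) wt (2 ^ j))).
  apply: ler_sum => A AS; rewrite (big_pred1 (Ordinal (log_lt A AS))).
    by apply: mertens_weight_le; case/andP: (log_bounds A AS) => ->;
      rewrite expn_gt0.
  by move=> j; rewrite eq_sym.
rewrite (exchange_big_dep xpredT) //= -[leRHS]mulrA.
apply: le_trans (_ : \sum_(j < J) 2 * K%:R * (2 * wt 2) ^+ j <= _); last first.
  by rewrite -mulr_sumr ler_wpM2l ?mulr_ge0 ?sum_geometric_mertens_weight2.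
apply: ler_sum => j _;
  rewrite sumr_const mertens_weightX exprMn -[leLHS]mulr_natl mulrA.
apply: ler_wpM2r; first by rewrite exprn_ge0 ?mertens_weight_ge0.
rewrite -natrX -!natrM ler_nat.
apply: (@leq_trans #|[set A in S | (nu A <= 2 ^ j.+1)%N]|).
  apply/subset_leq_card/subsetP => A; rewrite !inE => /andP [AS /eqP <-].
  by rewrite AS; case/andP: (log_bounds A AS) => _ /ltnW.
by apply: leq_trans (card_le _ _) _; rewrite ?expn_gt0 // expnS; lia.
Qed.

Lemma sum_mertens_weight_ge Y0 : (0 < Y0 <= x)%N -> (0 < K)%N ->
    (forall Y, (Y0 <= Y <= x)%N ->
      (Y <= K * #|[set A in S | (nu A <= Y)%N]|)%N) ->
  expR (-1) / K%:R * (ln (x%:R : R) - ln (Y0.+1%:R : R))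
    <= \sum_(A in S) wt (nu A).
Proof.
move=> /andP [Y0_gt0 Y0x] K0 card_ge.
have K_gt0 : 0 < K%:R :> R by rewrite ltr0n.
apply: (@le_trans _ _ (expR (-1) * \sum_(A in S | (nu A <= x)%N) (nu A)%:R^-1));
  last first.
  rewrite big_mkcondr mulr_sumr; apply: ler_sum => A /nu_gt0 nuA.
  case: ifP => [nux|_]; last by rewrite mulr0 mertens_weight_ge0.
  by rewrite mertens_weight_ge_inv ?nuA.
rewrite -mulrA ler_pM2l ?expR_gt0 // mulrC ler_pdivrMr //.
apply: le_trans (_ : \sum_(Y0 <= Y < x) Y.+1%:R^-1 <= _).
  apply: le_trans (harmonic_ge_ln _ Y0x);
    rewrite lerD2r ler_ln ?posrE ?ltr0n ?ler_nat //.
  exact: leq_trans Y0x.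
apply: le_trans (ler_wpM2r (ltW K_gt0) (sum_card_le_sum_inv R nu_gt0 x Y0_gt0)).
rewrite mulr_suml; apply: ler_sum_nat => Y /andP [Y0Y Yx].
have Y_gt0 : 0 < Y%:R :> R by rewrite ltr0n (leq_trans Y0_gt0).
have -> : Y%:R^-1 - Y.+1%:R^-1 = (Y%:R * Y.+1%:R)^-1 :> R.
  by rewrite -natr1; field; lra.
rewrite mulrAC invfM mulrA ler_peMl ?invr_ge0 // ler_pdivlMr // mul1r.
by rewrite -natrM ler_nat mulnC card_ge // Y0Y ltnW.
Qed.

End SumOverSets.
End MertensWeight.

(** * Roots modulo primes on average *)

Definition nb_roots (f : {poly int}) (p : nat) : nat :=
  #|[set r : 'I_p | (p %| f.[(val r)%:Z])%Z]|.

Lemma nb_roots_Fp f p : prime p ->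
  nb_roots f p = #|[set z : 'F_p | root (map_poly intr f) z]|.
Proof.
move=> pr_p; have pF := pchar_Fp pr_p.
pose residue (r : 'I_p) : 'F_p := (val r)%:Z%:~R.
have residue_inj : injective residue.
  move=> r s /eqP;
    rewrite (intr_pchar_eq _ _ pF) -eqz_mod_dvd !modz_nat eqz_nat.
  by rewrite !modn_small ?ltn_ord // => /eqP /val_inj.
rewrite /nb_roots -(card_imset _ residue_inj); apply: eq_card => z.
apply/imsetP/idP => [[r + ->]|]; first by rewrite !inE (root_intr_pchar _ _ pF).
rewrite inE => rz; have zp : (z < p)%N by rewrite -{2}(Fp_cast pr_p) ltn_ord.
have zE : z = residue (Ordinal zp) by rewrite /residue /= -pmulrn natr_Zp.
by exists (Ordinal zp);
  rewrite // inE -(root_intr_pchar _ _ pF) -/(residue _) -zE.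
Qed.

Lemma nb_roots_le f p :
  prime p -> f \is monic -> (nb_roots f p <= (size f).-1)%N.
Proof.
move=> pr_p f_monic; have f0 : map_poly (intr : int -> 'F_p) f != 0.
  by rewrite monic_neq0 ?monic_map.
rewrite nb_roots_Fp // cardE -ltnS prednK ?size_poly_gt0 ?monic_neq0 //.
rewrite -(@size_map_poly_id0 _ _ (intr : int -> 'F_p)); last first.
  by rewrite (monicP f_monic) oner_neq0.
apply: max_poly_roots; rewrite ?enum_uniq //.
by apply/allP => z; rewrite mem_enum inE.
Qed.

Lemma nb_rootsX p : prime p -> nb_roots 'X p = 1%N.
Proof.
move=> pr_p; rewrite nb_roots_Fp // map_polyX -(cards1 (0 : 'F_p)).
by apply: eq_card => z; rewrite !inE rootX.
Qed.

Definition mertens_sum (R : realType) (x : nat) (F : nat -> R) : R :=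
  \sum_(p < x.+1 | prime p) F p * mertens_weight R x p.

Section MertensSum.
Variables (R : realType) (x : nat).
Local Notation wt := (mertens_weight R x).

Lemma eq_mertens_sum F G : (forall p, prime p -> F p = G p) ->
  mertens_sum x F = mertens_sum x G :> R.
Proof. by move=> FG; apply: eq_bigr => p /FG ->. Qed.

Lemma mertens_sumB F G :
  mertens_sum x (fun p => F p - G p) = mertens_sum x F - mertens_sum x G :> R.
Proof.
by rewrite /mertens_sum -sumrB; apply: eq_bigr => p _; rewrite mulrBl.
Qed.

Lemma mertens_sumD F G :
  mertens_sum x (fun p => F p + G p) = mertens_sum x F + mertens_sum x G :> R.
Proof.
by rewrite /mertens_sum -big_split; apply: eq_bigr => p _; rewrite mulrDl.
Qed.

Lemma mertens_sumZ (k : R) F :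
  mertens_sum x (fun p => k * F p) = k * mertens_sum x F.
Proof.
by rewrite /mertens_sum mulr_sumr; apply: eq_bigr => p _; rewrite mulrA.
Qed.

Lemma mertens_sum_sum (I : finType) (F : I -> nat -> R) :
  mertens_sum x (fun p => \sum_i F i p) = \sum_i mertens_sum x (F i).
Proof.
by rewrite /mertens_sum exchange_big; apply: eq_bigr => p _; rewrite mulr_suml.
Qed.

Lemma ler_mertens_sum F G : (forall p, prime p -> F p <= G p) ->
  mertens_sum x F <= mertens_sum x G :> R.
Proof.
move=> FG; apply: ler_sum => p /FG/ler_wpM2r.
by apply; apply: mertens_weight_ge0.
Qed.

Lemma mertens_sum_indicator_le (P : pred nat) (B : nat) : 1 <= ln (x%:R : R) ->
    (forall p, prime p -> P p -> (p <= B)%N) ->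
  mertens_sum x (fun p => (P p)%:R) <= B.+1%:R :> R.
Proof.
move=> ln_x P_le; apply: (@le_trans _ _ (\sum_(p < x.+1 | prime p && P p) 1)).
  rewrite big_mkcondr; apply: ler_sum => p pr_p; case: (P p); rewrite ?mul0r //.
  by rewrite mul1r mertens_weight_le1 ?prime_gt0.
rewrite sumr_const ler_nat; apply: card_ord_ltn => p.
by rewrite unfold_in ltnS => /andP [pr_p /P_le]; apply.
Qed.

End MertensSum.

Lemma near_ln_ge (R : realType) (B : R) :
  (\forall x \near \oo, B <= ln (x%:R : R))%classic.
Proof.
near=> x; have x_large : expR B <= x%:R by near: x; apply: nbhs_infty_ger.
by rewrite -[B](expRK) ler_ln ?posrE ?expR_gt0 // (lt_le_trans (expR_gt0 B)).
Unshelve. all: by end_near. Qed.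

Lemma near_lnln_ge (R : realType) (B : R) :
  (\forall x \near \oo, B <= ln (ln (x%:R : R)))%classic.
Proof.
near=> x; have ln_x : expR B <= ln (x%:R : R) by near: x; apply: near_ln_ge.
by rewrite -[B](expRK) ler_ln ?posrE ?expR_gt0 // (lt_le_trans (expR_gt0 B)).
Unshelve. all: by end_near. Qed.

Lemma prod_1D_powerset (R : comNzRingType) (T : finType) (S : {set T})
    (g : T -> R) :
  \prod_(a in S) (1 + g a) = \sum_(A in powerset S) \prod_(a in A) g a.
Proof.
rewrite big_mkcond /= (eq_bigr (fun a => (if a \in S then g a else 0) + 1));
  last first.
  by move=> a _; case: ifP; rewrite ?add0r // addrC.
rewrite bigA_distr /= [RHS]big_mkcond /=; apply: eq_bigr => A _.
rewrite powersetE -big_mkcond;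
  case: ifP => [/subsetP sA|/negbT/subsetPn [a aA aS]].
  by apply: eq_bigr => a /sA ->.
by rewrite (bigD1 a) //= (negPf aS) mul0r.
Qed.

Lemma ln1D_bounds (R : realType) (w : R) :
  0 <= w -> w - w ^+ 2 <= ln (1 + w) <= w.
Proof.
move=> w0; have w1 : 0 < 1 + w by lra.
rewrite le_ln1Dx ?andbT; last lra.
apply: (@le_trans _ _ (w / (1 + w))).
  rewrite ler_pdivlMr // (_ : _ * _ = w - w ^+ 3); last by ring.
  by rewrite lerBlDr lerDl exprn_ge0.
rewrite -[ln _]opprK lerNr -lnV ?posrE //.
have := @le_ln1Dx R (- (w / (1 + w))).
rewrite (_ : 1 - w / (1 + w) = (1 + w)^-1); last by field; lra.
by apply; rewrite ltrNl opprK ltr_pdivrMr //; lra.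
Qed.

Lemma ln_prod (R : realType) (I : finType) (A : {set I}) (F : I -> R) :
  (forall i, 0 < F i) -> ln (\prod_(i in A) F i) = \sum_(i in A) ln (F i).
Proof.
move=> F0; suff : 0 < \prod_(i in A) F i /\
    ln (\prod_(i in A) F i) = \sum_(i in A) ln (F i) by case.
elim/big_rec2: _ => [|i s m _ [m0 <-]]; first by rewrite ln1.
by rewrite mulr_gt0 // lnM ?posrE.
Qed.

Lemma sum_ln_prod_1D_bounds (R : realType) (I : finType) (A : {set I})
    (w : I -> R) :
    (forall i, 0 <= w i) ->
  0 <= \sum_(i in A) w i - ln (\prod_(i in A) (1 + w i))
    <= \sum_(i in A) w i ^+ 2.
Proof.
move=> w0; rewrite ln_prod => [|i]; last by rewrite ltr_pwDl.
rewrite -sumrB; apply/andP; split.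
  by apply: sumr_ge0 => i _; rewrite subr_ge0;
    have /andP [] := ln1D_bounds (w0 i).
by apply: ler_sum => i _; have /andP [+ _] := ln1D_bounds (w0 i); lra.
Qed.

Lemma ex_char_poly (R : comNzRingType) n (f : {poly R}) :
  f \is monic -> size f = n.+2 -> exists M : 'M[R]_n.+1, char_poly M = f.
Proof.
move=> f_monic /(congr1 predn) /= size_f; case: _ / size_f.
by exists (companionmx f); apply: companionmxK.
Qed.

Section RootsMertens.
Variables (R : realType) (n : nat) (M : 'M[int]_n.+1).
Local Notation f := (char_poly M).
Local Notation wt := (mertens_weight R).
Hypothesis f_irr : irreducible_poly f.

Lemma sum_deg1_primes x (F : nat -> R) :
  \sum_(a in deg1_primes f x) F a.1 =
  \sum_(p < x.+1 | prime p && unramified f p) (nb_roots f p)%:R * F p.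
Proof.
rewrite (eq_bigl (fun a : 'I_x.+1 * 'I_x.+1 =>
  (prime a.1 && unramified f a.1) &&
  ((val a.1 %| f.[(val a.2)%:Z])%Z && (a.2 < a.1)%N))) => [|a]; last first.
  by rewrite inE -andbA [X in [&& _, _ & X]]andbC.
rewrite -(pair_big_dep (fun p : 'I_x.+1 => prime p && unramified f p)
  (fun p r : 'I_x.+1 => (val p %| f.[(val r)%:Z])%Z && (r < p)%N)
    (fun p _ => F p)) /=.
apply: eq_bigr => p _; rewrite sumr_const mulr_natl; congr (_ *+ _).
rewrite -sum1_card -(big_ord_widen_cond x.+1 (fun r : nat =>
  (val p %| f.[r%:Z])%Z) (fun=> 1%N)).
  by rewrite sum1dep_card.
exact: ltnW (ltn_ord p).
Qed.

Lemma nb_roots_char_poly_le p : prime p -> (nb_roots f p <= n.+1)%N.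
Proof.
by move=> pr_p; have := nb_roots_le pr_p (char_poly_monic M);
  rewrite size_char_poly.
Qed.

Lemma sum_sq_deg1_primes_le x : 1 <= ln (x%:R : R) ->
  \sum_(a in deg1_primes f x) wt x a.1 ^+ 2 <= n.+1%:R * 2.
Proof.
move=> ln_x; rewrite (sum_deg1_primes x (fun p => wt x p ^+ 2)).
apply: (@le_trans _ _ (n.+1%:R * \sum_(1 <= p < x.+1) p%:R ^- 2)).
  rewrite big_geq_mkord mulr_sumr big_mkcond [leRHS]big_mkcond;
    apply: ler_sum => p _ /=.
  have term_ge0 : 0 <= n.+1%:R * p%:R ^- 2 :> R.
    by rewrite mulr_ge0 ?invr_ge0 ?exprn_ge0.
  case: ifP => [/andP [pr_p _]|_]; last by case: ifP.
  have p0 := prime_gt0 pr_p;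
    rewrite p0 ler_pM ?exprn_ge0 ?mertens_weight_ge0 //.
    by rewrite ler_nat nb_roots_char_poly_le.
  by rewrite -exprVn lerXn2r ?nnegrE ?invr_ge0 ?mertens_weight_ge0
    ?mertens_weight_le_inv.
rewrite ler_wpM2l //; case: x {ln_x} => [|x]; first by rewrite big_geq.
rewrite big_ltn // expr1n invr1; have := sum_inv_sq_le R x.+2 (isT : (0 < 1)%N).
by rewrite invr1; lra.
Qed.

Lemma prod_deg1_primes x :
  \prod_(a in deg1_primes f x) (1 + wt x a.1) =
  \sum_(A in powerset (deg1_primes f x)) wt x (set_norm A).
Proof.
rewrite prod_1D_powerset; apply: eq_bigr => A _.
by rewrite /set_norm mertens_weight_prod.
Qed.

Lemma prod_deg1_primes_bounds : exists C : R,
  (\forall x \near \oo, ln (ln (x%:R : R)) - C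
    <= ln (\prod_(a in deg1_primes f x) (1 + wt x a.1))
    <= ln (ln x%:R) + C)%classic.
Proof.
have [K K_gt0 card_le] := card_deg1_sets_le f_irr.
have [K' [Y0 [K'_gt0 card_ge]]] := card_deg1_sets_ge f_irr.
have norm_gt0 x : {in powerset (deg1_primes f x), forall A, (0 < set_norm A)%N}.
  by move=> A; rewrite powersetE => /set_norm_gt0.
pose upper : R := 2 * K%:R * (1 + (ln 2)^-1).
pose lower : R := expR (-1) / K'%:R / 2.
have upper_gt0 : 0 < upper.
  by rewrite !mulr_gt0 ?ltr0n // addr_gt0 // invr_gt0 ln_gt0 // ltr1n.
have lower_gt0 : 0 < lower by rewrite !divr_gt0 ?expR_gt0 ?ltr0n.
exists (`|ln upper| + `|ln lower|); near=> x.
have ln_x : 1 <= ln (x%:R : R) by near: x; apply: near_ln_ge.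
have ln_x_large : 2 * ln (Y0.+2%:R : R) <= ln (x%:R : R).
  by near: x; apply: near_ln_ge.
have Y0x : (0 < Y0.+1 <= x)%N by near: x; exists Y0.+1.
have ln_x_gt0 : 0 < ln (x%:R : R) := lt_le_trans ltr01 ln_x.
have prod_le : \prod_(a in deg1_primes f x) (1 + wt x a.1)
  <= upper * ln (x%:R : R).
  rewrite prod_deg1_primes.
  by apply: (sum_mertens_weight_le ln_x (@norm_gt0 x)) => Y; apply: card_le.
have prod_ge : lower * ln (x%:R : R)
  <= \prod_(a in deg1_primes f x) (1 + wt x a.1).
  rewrite prod_deg1_primes.
  apply: le_trans (sum_mertens_weight_ge ln_x (@norm_gt0 x) Y0x K'_gt0 _) =>
    [|Y /andP [Y0Y Yx]].
    by rewrite /lower -mulrA ler_pM2l ?divr_gt0 ?expR_gt0 ?ltr0n //; lra.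
  by apply: card_ge; rewrite (ltnW Y0Y).
have prod_gt0 := lt_le_trans (mulr_gt0 lower_gt0 ln_x_gt0) prod_ge.
have ln_prod_le : ln (\prod_(a in deg1_primes f x) (1 + wt x a.1))
  <= ln upper + ln (ln x%:R).
  by rewrite -lnM ?posrE // ler_ln ?posrE // (mulr_gt0 upper_gt0).
have ln_prod_ge : ln lower + ln (ln x%:R)
  <= ln (\prod_(a in deg1_primes f x) (1 + wt x a.1)).
  by rewrite -lnM ?posrE // ler_ln ?posrE // (mulr_gt0 lower_gt0).
have := ler_norm (ln upper); have := ler_norm (- ln lower); rewrite normrN.
have := normr_ge0 (ln upper); have := normr_ge0 (ln lower).
by move=> *; apply/andP; split; lra.
Unshelve. all: by end_near. Qed.

Lemma mertens_sum_nb_roots_sub_deg1_primes : exists C : R,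
  forall x, 1 <= ln (x%:R : R) ->
    0 <= mertens_sum x (fun p => (nb_roots f p)%:R) -
         \sum_(a in deg1_primes f x) wt x a.1 <= C.
Proof.
have [B unram] := ex_unramified_above (char_poly_monic M) f_irr.
exists (n.+1%:R * B.+1%:R) => x ln_x; rewrite (sum_deg1_primes x (wt x)).
rewrite /mertens_sum (bigID (fun p : 'I_x.+1 => unramified f p)) /=.
rewrite [X in X - _]addrC addrK.
apply/andP; split.
  by apply: sumr_ge0 => p _; rewrite mulr_ge0 ?mertens_weight_ge0.
pose ramified p := ~~ unramified f p.
apply: (@le_trans _ _ (n.+1%:R * mertens_sum x (fun p => (ramified p)%:R)));
  last first.
  rewrite ler_wpM2l ?mertens_sum_indicator_le // => p pr_p; apply: contraR.
  by rewrite -ltnNge; apply: unram.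
rewrite -mertens_sumZ big_mkcondr; apply: ler_sum => p pr_p; rewrite /ramified.
case: ifP => _; last by rewrite mulr0 mul0r.
by rewrite ler_wpM2r ?mertens_weight_ge0 // mulr1 ler_nat nb_roots_char_poly_le.
Qed.

Lemma char_poly_roots_mertens : exists C : R,
  (\forall x \near \oo,
    `|mertens_sum x (fun p => (nb_roots f p)%:R)
      - ln (ln (x%:R : R))| <= C)%classic.
Proof.
have [Cprod prod_bounds] := prod_deg1_primes_bounds.
have [Cram ram_bounds] := mertens_sum_nb_roots_sub_deg1_primes.
exists (`|Cprod| + n.+1%:R * 2 + `|Cram|); near=> x.
have ln_x : 1 <= ln (x%:R : R) by near: x; apply: near_ln_ge.
have /andP [prod_ge prod_le] : ln (ln (x%:R : R)) - Cprod
    <= ln (\prod_(a in deg1_primes f x) (1 + wt x a.1)) <= ln (ln x%:R) + Cprod.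
  by near: x; apply: prod_bounds.
have /andP [log_ge log_le] := sum_ln_prod_1D_bounds (deg1_primes f x)
  (fun a => mertens_weight_ge0 R x a.1).
have sq_le := sum_sq_deg1_primes_le ln_x;
  have /andP [ram_ge ram_le] := ram_bounds x ln_x.
have := ler_norm Cprod; have := ler_norm Cram.
have := normr_ge0 Cprod; have := normr_ge0 Cram; have := ler0n R n.+1.
by rewrite ler_norml => *; apply/andP; split; lra.
Unshelve. all: by end_near. Qed.

End RootsMertens.

Theorem roots_mertens (R : realType) (f : {poly int}) :
    f \is monic -> irreducible_poly f ->
  exists C : R, (\forall x \near \oo,
    `|mertens_sum x (fun p => (nb_roots f p)%:R)
      - ln (ln (x%:R : R))| <= C)%classic.
Proof.
move=> f_monic f_irr; have [size_f _] := f_irr.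
have [M fE] : exists M : 'M[int]_((size f).-2.+1), char_poly M = f.
  by apply: ex_char_poly => //; move: size_f; case: (size f) => [|[]].
by rewrite -fE in f_irr *; apply: char_poly_roots_mertens.
Qed.

(** * Kummer polynomials *)

Lemma ex_exp_of_dvdp_XnsubC (F : fieldType) (L : closedFieldType)
    (h : {rmorphism F -> L}) q (b : F) g :
    (0 < q)%N -> g %| 'X^q - b%:P ->
  exists a : F, a ^+ q = b ^+ (size g).-1.
Proof.
move=> q0 gF; have g0 : g != 0.
  by apply: contraTneq gF => ->; rewrite dvd0p monic_neq0 // monicXnsubC.
have lead_g0 : lead_coef g != 0 by rewrite lead_coef_eq0.
have [rs] := closed_field_poly_normal ('X^q - (h b)%:P).
rewrite lead_coefXnsubC // scale1r => rsE.
have rs_exp z : z \in rs -> z ^+ q = h b.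
  move=> zrs; have : root ('X^q - (h b)%:P) z by rewrite rsE root_prod_XsubC.
  by rewrite rootE !hornerE subr_eq0 => /eqP.
have : map_poly h g %| \prod_(z <- rs) ('X - z%:P).
  by rewrite -rsE -map_polyC -(map_polyXn h) -rmorphB dvdp_map.
case/dvdp_prod_XsubC => m; set s := mask m rs => hgE.
have size_s : size s = (size g).-1.
  by have := eqp_size hgE; rewrite size_prod_XsubC size_map_poly => ->.
have coef0 : h g`_0 = h (lead_coef g) * \prod_(z <- s) - z.
  have /eqpf_eq [k k0 kE] := hgE.
  have -> : h (lead_coef g) = k.
    rewrite -lead_coef_map kE lead_coefZ.
    by rewrite (monicP (monic_prod_XsubC _ _ _)) mulr1.
  rewrite -coef_map -horner_coef0 kE hornerZ horner_prod; congr (_ * _).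
  by apply: eq_bigr => z _; rewrite hornerXsubC sub0r.
exists ((-1) ^+ size s * (g`_0 / lead_coef g)); apply: (fmorph_inj h).
rewrite rmorphXn [RHS]rmorphXn /=.
have -> : h ((-1) ^+ size s * (g`_0 / lead_coef g)) = \prod_(z <- s) z.
  rewrite rmorphM rmorph_sign rmorphM fmorphV coef0 mulrAC mulfV
    ?fmorph_eq0 // mul1r.
  under eq_bigr do rewrite -mulN1r.
  rewrite big_split big_const_seq count_predT iter_mulr_1 /=.
  by rewrite mulrA -exprD addnn -mul2n exprM sqrrN !expr1n mul1r.
rewrite -size_s -prodrXl big_seq (eq_bigr (fun=> h b)) =>
  [|z /mem_mask /rs_exp //].
by rewrite -big_seq big_const_seq count_predT iter_mulr_1.
Qed.

Lemma ex_root_of_coprime_exp (F : fieldType) q k (a b : F) :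
    (0 < q)%N -> (0 < k)%N -> coprime k q -> a ^+ q = b ^+ k ->
  exists c, c ^+ q = b.
Proof.
move=> q0 k0 cop aE; have [->|b0] := eqVneq b 0.
  by exists 0; rewrite expr0n gtn_eqF.
have [u v uk _] := egcdnP q k0; rewrite (eqP cop) in uk.
exists (a ^+ u / b ^+ v); rewrite exprMn exprVn -!exprM mulnC exprM aE -exprM.
by rewrite mulnC uk addn1 exprS mulfK ?expf_neq0.
Qed.

Lemma ex_int_root_of_rat_root q (a : rat) (b : int) :
    (0 < q)%N -> a ^+ q = b%:~R ->
  exists m : int, m ^+ q = b.
Proof.
move=> q0 aE; have : (ratr a : algC) \in Aint.
  apply: (@root_monic_Aint ('X^q - (b%:~R)%:P)).
  - by rewrite rootE !hornerE -rmorphXn aE /= ratr_int subrr.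
  - exact: monicXnsubC.
  - apply/polyOverP => i; rewrite -(map_polyXn (intr : int -> algC)) -map_polyC.
    by rewrite -rmorphB coef_map intr_int.
move/(Cint_rat_Aint (Crat_rat a)); rewrite Cint_rat => /intrP [m aE'].
by exists m; apply: (@intr_inj rat); rewrite rmorphXn /= -aE' aE.
Qed.

Section PowerPoly.
Variable q : nat.
Hypothesis q_gt0 : (0 < q)%N.

Definition power_poly (b : int) : {poly int} := 'X^q - b%:P.

Lemma power_poly_monic b : power_poly b \is monic.
Proof. exact: monicXnsubC. Qed.

Lemma size_power_poly b : size (power_poly b) = q.+1.
Proof. exact: size_XnsubC. Qed.

Lemma nb_roots_power_poly p b : prime p ->
  nb_roots (power_poly b) p = #|[set z : 'F_p | z ^+ q == b%:~R]|.
Proof.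
move=> pr_p; rewrite nb_roots_Fp //; apply: eq_card => z; rewrite !inE rootE.
by rewrite rmorphB /= map_polyXn map_polyC /= !hornerE subr_eq0.
Qed.

Lemma irreducible_power_poly (b : int) :
    prime q -> (forall m : int, m ^+ q <> b) ->
  irreducible_poly (power_poly b).
Proof.
move=> pr_q b_nonpower; apply/irreducible_rat_int.
have FE : map_poly intr (power_poly b) = 'X^q - (b%:~R)%:P :> {poly rat}.
  by rewrite rmorphB /= map_polyXn map_polyC.
rewrite FE; split=> [|g size_g gF]; first by rewrite size_XnsubC // ltnS.
rewrite -dvdp_size_eqp // size_XnsubC //; apply/negPn/negP => proper.
have g_lt : (size g <= q.+1)%N.
  by rewrite -(size_XnsubC (b%:~R : rat) q_gt0) dvdp_leq // monic_neq0
    ?monicXnsubC.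
have g_gt0 : (0 < size g)%N.
  by rewrite size_poly_gt0; apply: contraTneq gF => ->;
    rewrite dvd0p monic_neq0 ?monicXnsubC.
have [a aE] := ex_exp_of_dvdp_XnsubC (ratr : {rmorphism rat -> algC}) q_gt0 gF.
have deg_gt0 : (0 < (size g).-1)%N by lia.
have cop : coprime (size g).-1 q.
  by rewrite coprime_sym prime_coprime // gtnNdvd //; lia.
have [c cE] := ex_root_of_coprime_exp q_gt0 deg_gt0 cop aE.
by have [m /b_nonpower] := ex_int_root_of_rat_root q_gt0 cE.
Qed.

(* The qth cyclotomic polynomial evaluated at X + 1, which is Eisenstein at q. *)
Definition shifted_cyclotomic : {poly int} := \poly_(i < q) 'C(q, i.+1)%:Z.

Lemma shifted_cyclotomicE : shifted_cyclotomic * 'X = ('X + 1) ^+ q - 1.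
Proof.
rewrite exprD1n big_ord_recl /= expr0 bin0 mulr1n addrC addKr.
rewrite /shifted_cyclotomic poly_def mulr_suml; apply: eq_bigr => i _.
by rewrite -scalerAl -exprSr -[_%:Z]natz scaler_nat /bump /= add1n.
Qed.

Lemma size_shifted_cyclotomic : size shifted_cyclotomic = q.
Proof. by rewrite size_poly_eq // prednK // binn. Qed.

Lemma shifted_cyclotomic_monic : shifted_cyclotomic \is monic.
Proof.
by rewrite monicE lead_coefE size_shifted_cyclotomic coef_poly
  prednK // leqnn binn.
Qed.

Lemma irreducible_shifted_cyclotomic :
  prime q -> irreducible_poly shifted_cyclotomic.
Proof.
move=> pr_q; have q1 := prime_gt1 pr_q; apply: (eisenstein_crit pr_q).
- by rewrite size_shifted_cyclotomic gtn_eqF.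
- by rewrite (monicP shifted_cyclotomic_monic) dvdzE /= dvdn1 gtn_eqF.
- rewrite coef_poly q_gt0 bin1 natrXE dvdzE /= -mulnn;
    apply/negP => /(dvdn_leq q_gt0).
  by nia.
- move=> i; rewrite size_shifted_cyclotomic => iq; rewrite coef_poly.
  by case: ifP => // _; rewrite dvdzE /=; apply: prime_dvd_bin => //; lia.
Qed.

Lemma nb_roots_power_poly1 p : prime q -> prime p -> p != q ->
  nb_roots (power_poly 1) p = (nb_roots shifted_cyclotomic p).+1.
Proof.
move=> pr_q pr_p pq; have pF := pchar_Fp pr_p.
rewrite nb_roots_power_poly // nb_roots_Fp //.
set g := map_poly intr shifted_cyclotomic : {poly 'F_p}.
have gE z : g.[z] * z = (z + 1) ^+ q - 1.
  have := congr1 (map_poly (intr : int -> 'F_p)) shifted_cyclotomicE.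
  rewrite rmorphM rmorphB rmorphXn rmorphD /= map_polyX rmorph1.
  by move/(congr1 (horner_eval z)); rewrite /horner_eval !hornerE.
have g0 : ~~ root g 0.
  rewrite rootE horner_coef0 coef_map /= coef_poly q_gt0 bin1.
  by rewrite -(dvdz_pcharf pF) dvdzE /= dvdn_prime2.
have -> : [set z : 'F_p | z ^+ q == 1%:~R]
  = 1 |: [set z + 1 | z in [set z | root g z]].
  apply/setP => y; rewrite !inE;
    apply/idP/orP => [/eqP yq|[/eqP ->|/imsetP [z + ->]]].
  - have [->|y1] := eqVneq y 1; [by left|right]; apply/imsetP.
    exists (y - 1); last by rewrite subrK.
    rewrite inE rootE; have := gE (y - 1); rewrite subrK yq subrr => /eqP.
    by rewrite mulf_eq0 subr_eq0 (negPf y1) orbF.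
  - by rewrite expr1n.
  - rewrite inE => /rootP gz; have := gE z; rewrite gz mul0r => /esym/eqP.
    by rewrite subr_eq0.
rewrite cardsU1 card_imset; last exact: addIr.
suff -> : (1 : 'F_p) \notin [set z + 1 | z in [set z | root g z]].
  by rewrite add1n.
apply/imsetP => -[z]; rewrite inE => rz /eqP;
  rewrite eq_sym -subr_eq0 addrK => /eqP z0.
by move: rz; rewrite z0 (negPf g0).
Qed.

End PowerPoly.

Lemma mertens_sum1 (R : realType) : exists C : R,
  (\forall x \near \oo, `|mertens_sum x (fun=> 1)
    - ln (ln (x%:R : R))| <= C)%classic.
Proof.
have irr_X : irreducible_poly ('X : {poly int}).
  by rewrite -['X]subr0; apply: irredp_XsubC.
have [C near_X] := roots_mertens R (monicX _) irr_X; exists C.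
near=> x; suff -> : mertens_sum x (fun=> 1) =
    mertens_sum x (fun p => (nb_roots 'X p)%:R) :> R by near: x.
by apply: eq_mertens_sum => p pr_p; rewrite nb_rootsX.
Unshelve. all: by end_near. Qed.

Definition root_excess (R : realType) (f : {poly int}) (p : nat) : R :=
  (nb_roots f p)%:R - 1.

Lemma mertens_sum_root_excess_bounded (R : realType) f :
    f \is monic -> irreducible_poly f ->
  exists C : R, (\forall x \near \oo,
    `|mertens_sum x (root_excess R f)| <= C)%classic.
Proof.
move=> f_monic f_irr; have [Cf near_f] := roots_mertens R f_monic f_irr.
have [C1 near_1] := mertens_sum1 R; exists (Cf + C1); near=> x.
have : `|mertens_sum x (fun p => (nb_roots f p)%:R) - ln (ln (x%:R : R))| <= Cf.
  by near: x.
have : `|mertens_sum x (fun=> 1) - ln (ln (x%:R : R))| <= C1 by near: x.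
by rewrite /root_excess mertens_sumB !ler_norml => /andP [? ?] /andP [? ?];
  apply/andP; split; lra.
Unshelve. all: by end_near. Qed.

Lemma mertens_sum_root_excess_unity_ge (R : realType) q : prime q ->
  exists C : R, (\forall x \near \oo,
    ln (ln (x%:R : R)) - C
    <= mertens_sum x (root_excess R (power_poly q 1)))%classic.
Proof.
move=> pr_q; have [C near_cycl] :=
  roots_mertens R (shifted_cyclotomic_monic (prime_gt0 pr_q))
  (irreducible_shifted_cyclotomic (prime_gt0 pr_q) pr_q).
exists (C + q%:R * q.+1%:R); near=> x.
have ln_x : 1 <= ln (x%:R : R) by near: x; apply: near_ln_ge.
have : `|mertens_sum x (fun p => (nb_roots (shifted_cyclotomic q) p)%:R)
  - ln (ln (x%:R : R))| <= C.
  by near: x.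
have q_le : mertens_sum x (fun p => (p == q)%:R) <= q.+1%:R :> R.
  by apply: mertens_sum_indicator_le => // p _ /eqP ->.
have {q_le} := ler_wpM2l (ler0n R q) q_le.
have : mertens_sum x (fun p => (nb_roots (shifted_cyclotomic q) p)%:R)
    - q%:R * mertens_sum x (fun p => (p == q)%:R)
    <= mertens_sum x (root_excess R (power_poly q 1)).
  rewrite -mertens_sumZ -mertens_sumB; apply: ler_mertens_sum => p pr_p.
  rewrite /root_excess.
  have [pq|pq] := eqVneq p q; last first.
    by rewrite nb_roots_power_poly1 ?prime_gt0 // -natr1 addrK mulr0 subr0.
  have := nb_roots_le pr_p (shifted_cyclotomic_monic (prime_gt0 pr_q)).
  rewrite size_shifted_cyclotomic ?prime_gt0 // mulr1 -(ler_nat R)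
    -[X in _ - X%:R](prednK (prime_gt0 pr_q)).
  by rewrite -natr1; have := ler0n R (nb_roots (power_poly q 1) p); lra.
by rewrite ler_norml => ? ? /andP [? ?]; lra.
Unshelve. all: by end_near. Qed.

Lemma near_sum_ge (R : numDomainType) (T : Type) (F : set_system T)
    (I : finType) (P : pred I) (g : I -> T -> R) : Filter F ->
    (forall i, P i -> exists C, (\forall x \near F, C <= g i x)%classic) ->
  exists C, (\forall x \near F, C <= \sum_(i | P i) g i x)%classic.
Proof.
move=> FF g_ge; have /choice [C near_C] i :
    exists C, P i -> (\forall x \near F, C <= g i x)%classic.
  by have [/g_ge [C]|] := boolP (P i); [exists C | exists 0].
exists (\sum_(i | P i) C i).
have : (\forall x \near F, forall i, P i -> C i <= g i x)%classic.
  apply: filter_forall => i; have [/near_C|_] := boolP (P i); last exact: nearW.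
  by apply: filterS.
by apply: filterS => x C_le; apply: ler_sum => i Pi; apply: C_le.
Qed.

(** * Kummer sums *)

Lemma card_exp_eq_mul_exp (F : finFieldType) q (b y : F) : y != 0 ->
  #|[set z : F | z ^+ q == b * y ^+ q]| = #|[set z : F | z ^+ q == b]|.
Proof.
move=> y0; rewrite -(card_imset (mem [set z : F | z ^+ q == b]) (mulIf y0)).
apply: eq_card => z; rewrite inE; apply/idP/imsetP => [/eqP zq|[w + ->]].
  exists (z / y); last by rewrite mulfVK.
  by rewrite inE expr_div_n zq mulfK ?expf_neq0.
by rewrite inE exprMn => /eqP ->.
Qed.

Section KummerSum.
Variables (R : realType) (q k : nat) (a : 'I_k -> int).
Hypothesis pr_q : prime q.
Local Notation exponent := {ffun 'I_k -> 'F_q}.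
Implicit Types (e : exponent).

Definition kummer_prod (e : exponent) : int := \prod_i a i ^+ (e i : nat).

Definition power_relation (e : exponent) : Prop :=
  exists m : int, m ^+ q = kummer_prod e.

Definition indep_mod_powers : Prop := forall e, e != 0 -> ~ power_relation e.

Lemma kummer_prod0 : kummer_prod 0 = 1.
Proof. by rewrite /kummer_prod big1 // => i _; rewrite ffunE expr0. Qed.

Lemma indep_mod_powers_neq0 i : indep_mod_powers -> a i != 0.
Proof.
move=> indep; apply/eqP => ai0; pose e : exponent := [ffun j => (j == i)%:R].
have : e != 0.
  by apply/eqP => /ffunP /(_ i); rewrite !ffunE eqxx => /eqP; rewrite oner_eq0.
move/indep; apply; exists 0; rewrite expr0n gtn_eqF ?prime_gt0 //.
have ei0 : (e i : nat) != 0%N.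
  rewrite ffunE eqxx; apply/eqP => /(congr1 (fun j : nat => j%:R : 'F_q)).
  by rewrite natr_Zp => /eqP; rewrite oner_eq0.
by rewrite /kummer_prod (bigD1 i) //= ai0 expr0n (negPf ei0) mul0r.
Qed.

Definition kummer_weight (e : exponent) : R := q%:R * (\sum_i e i == 0)%:R - 1.

Definition kummer_sum (p : nat) : R :=
  \sum_(e : exponent)
    kummer_weight e * root_excess R (power_poly q (kummer_prod e)) p.

Lemma kummer_weight0 : kummer_weight 0 = q%:R - 1.
Proof.
by rewrite /kummer_weight big1 ?eqxx ?mulr1 // => i _; rewrite ffunE.
Qed.

Lemma kummer_weight_le e : `|kummer_weight e| <= q%:R.
Proof.
rewrite /kummer_weight; have q1 : 1 <= q%:R :> R by rewrite ler1n prime_gt0.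
by rewrite ler_norml; case: (_ == _); rewrite ?mulr1 ?mulr0;
  apply/andP; split; lra.
Qed.

Definition shift_exponent (i : 'I_k) (t : 'F_q) (e : exponent) : exponent :=
  [ffun j => if j == i then e j + t else e j].

Lemma shift_exponent_inj i t : injective (shift_exponent i t).
Proof.
move=> e e' /ffunP E; apply/ffunP => j; have := E j; rewrite !ffunE.
by case: ifP => // _ /addIr.
Qed.

Lemma sum_kummer_weight_shift i e :
  \sum_(t : 'F_q) kummer_weight (shift_exponent i t e) = 0.
Proof.
have sum_shift t : \sum_j shift_exponent i t e j = \sum_j e j + t.
  rewrite (bigD1 i) //= ffunE eqxx [in RHS](bigD1 i) //= addrAC;
    congr (_ + _ + _).
  by apply: eq_bigr => j /negPf ji; rewrite ffunE ji.
rewrite /kummer_weight sumrB -mulr_sumr sumr_const card_Fp //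
  (bigD1 (- \sum_j e j)) //=.
rewrite sum_shift subrr eqxx big1 ?addr0 ?mulr1 ?subrr // => t nt.
by rewrite sum_shift addrC addr_eq0 (negPf nt).
Qed.

Lemma nb_roots_shift_exponent p i t e :
    prime p -> ~~ (p %| a i)%Z -> qth_power_mod q p (a i) ->
  nb_roots (power_poly q (kummer_prod (shift_exponent i t e))) p =
  nb_roots (power_poly q (kummer_prod e)) p.
Proof.
move=> pr_p pai [y0 yE]; have pF := pchar_Fp pr_p; have q0 := prime_gt0 pr_q.
pose y : 'F_p := y0%:~R.
have ayE : (a i)%:~R = y ^+ q.
  apply/eqP; rewrite -subr_eq0 -rmorphXn -rmorphB /= -(dvdz_pcharf pF).
  by rewrite -eqz_mod_dvd.
have y_neq0 : y != 0.
  by apply: contra pai => /eqP yz;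
    rewrite (dvdz_pcharf pF) ayE yz expr0n gtn_eqF.
pose b (e : exponent) : 'F_p := \prod_(j | j != i) (a j)%:~R ^+ (e j : nat).
have nb_roots_rest e' : nb_roots (power_poly q (kummer_prod e')) p =
    #|[set z : 'F_p | z ^+ q == b e']|.
  rewrite nb_roots_power_poly // -(@card_exp_eq_mul_exp _ q (b e')
    (y ^+ (e' i : nat))) ?expf_neq0 //.
  apply: eq_card => z; rewrite !inE; congr (_ == _).
  rewrite rmorph_prod (bigD1 i) //= rmorphXn /= ayE -!exprM
    [(q * _)%N]mulnC mulrC.
  by congr (_ * _); apply: eq_bigr => j _; rewrite rmorphXn.
rewrite !nb_roots_rest; suff -> : b (shift_exponent i t e) = b e by [].
by apply: eq_bigr => j /negPf ji; rewrite ffunE ji.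
Qed.

(* Shifting e i by t changes no root count when a i is a qth power modulo p, while
   the weights add up to zero over t. *)
Lemma kummer_sum_eq0 p i :
    prime p -> ~~ (p %| a i)%Z -> qth_power_mod q p (a i) ->
  kummer_sum p = 0.
Proof.
move=> pr_p pai ai_power.
have kummer_sum_shift t : kummer_sum p =
    \sum_(e : exponent) kummer_weight (shift_exponent i t e)
      * root_excess R (power_poly q (kummer_prod e)) p.
  rewrite /kummer_sum (reindex_inj (@shift_exponent_inj i t)) /=.
  by apply: eq_bigr => e _; rewrite /root_excess nb_roots_shift_exponent.
have : \sum_(t : 'F_q) kummer_sum p = 0.
  under eq_bigr => t _ do rewrite (kummer_sum_shift t).
  rewrite exchange_big /= big1 // => e _.
  by rewrite -mulr_suml sum_kummer_weight_shift mul0r.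
by rewrite sumr_const card_Fp // => /eqP;
  rewrite mulrn_eq0 gtn_eqF ?prime_gt0 //= => /eqP.
Qed.

Lemma kummer_sum_le p :
  prime p -> kummer_sum p <= (#|{: exponent}| * (q * q.+1))%:R.
Proof.
move=> pr_p; apply: le_trans (ler_norm _) (le_trans (ler_norm_sum _ _ _) _).
rewrite natrM mulr_natl -sumr_const; apply: ler_sum => e _;
  rewrite normrM natrM.
apply: ler_pM => //; first exact: kummer_weight_le.
have := nb_roots_le pr_p (power_poly_monic (prime_gt0 pr_q) (kummer_prod e)).
rewrite size_power_poly ?prime_gt0 //= -(ler_nat R) -natr1 => roots_le.
by rewrite /root_excess ler_norml; apply/andP; split;
  have := ler0n R (nb_roots (power_poly q (kummer_prod e)) p); lra.
Qed.

Lemma mertens_sum_kummer_sum x :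
  mertens_sum x kummer_sum = \sum_(e : exponent) kummer_weight e *
    mertens_sum x (root_excess R (power_poly q (kummer_prod e))).
Proof.
rewrite mertens_sum_sum; apply: eq_bigr => e _; exact: mertens_sumZ.
Qed.

Lemma mertens_sum_kummer_sum_ge : indep_mod_powers ->
  exists C : R,
    (\forall x \near \oo, ln (ln (x%:R : R)) - C
      <= mertens_sum x kummer_sum)%classic.
Proof.
move=> indep; have [C0 near_unity] := mertens_sum_root_excess_unity_ge R pr_q.
have [|C1 near_rest] :=
  @near_sum_ge R _ \oo%classic _ [pred e : exponent | e != 0] (fun e x =>
    kummer_weight e
      * mertens_sum x (root_excess R (power_poly q (kummer_prod e)))).
  move=> e e0; have e_nonpower m : m ^+ q <> kummer_prod e.
    by move=> mE; apply: (indep e e0); exists m.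
  have [C near_e] := mertens_sum_root_excess_bounded R
    (power_poly_monic (prime_gt0 pr_q) (kummer_prod e))
    (irreducible_power_poly (prime_gt0 pr_q) pr_q e_nonpower).
  exists (- (q%:R * C)); apply: filterS near_e => x excess_le.
  rewrite lerNl (le_trans (ler_norm _)) // normrN normrM ler_pM //.
  exact: kummer_weight_le.
exists (C0 - C1); near=> x;
  rewrite mertens_sum_kummer_sum (bigD1 (0 : exponent)) //=.
rewrite opprB addrA -addrAC; apply: lerD; last by near: x.
have lnln_large : C0 <= ln (ln (x%:R : R)) by near: x; apply: near_lnln_ge.
have unity_ge : ln (ln (x%:R : R)) - C0 <=
    mertens_sum x (root_excess R (power_poly q 1)) by near: x.
have q2 : 2 <= q%:R :> R by rewrite ler_nat prime_gt1.
have unity_ge0 :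
    0 <= mertens_sum x (root_excess R (power_poly q 1)).
  by apply: le_trans unity_ge; rewrite subr_ge0.
rewrite kummer_prod0 kummer_weight0; apply: le_trans unity_ge _.
by rewrite ler_peMl //; lra.
Unshelve. all: by end_near. Qed.

End KummerSum.

(** * Sets containing a power modulo almost every prime are dependent *)

Lemma sum_mul_le_of_partial_sums (F : realFieldType)
    (d w : nat -> F) (B : F) x :
    (forall i, 0 <= w i) -> (forall i, w i.+1 <= w i) ->
    (forall m, \sum_(i < m) d i <= B) ->
  \sum_(i < x) d i * w i <= B * w 0%N.
Proof.
move=> w_ge0 w_decr d_le.
have B_ge0 : 0 <= B by have := d_le 0%N; rewrite big_ord0.
suff partial m : \sum_(i < m) d i * w i
  <= B * w 0%N - (B - \sum_(i < m) d i) * w m.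
  by apply: le_trans (partial x) _; rewrite gerBl mulr_ge0 // subr_ge0.
elim: m => [|m IH]; first by rewrite !big_ord0 subr0 subrr.
rewrite big_ord_recr; apply: le_trans (lerD IH (lexx _)) _.
rewrite big_ord_recr /= [leLHS](_ : _ = B * w 0%N
  - (B - (\sum_(i < m) d i + d m)) * w m).
  rewrite lerB // ler_wpM2l // subr_ge0.
  by have := d_le m.+1; rewrite big_ord_recr.
by ring.
Qed.

Lemma mertens_sum_le_of_partial_sums (R : realType) x (F : nat -> R) B :
    1 <= ln (x%:R : R) -> (forall m, \sum_(p < m.+1 | prime p) F p <= B) ->
  mertens_sum x F <= B.
Proof.
move=> ln_x partial_le.
have prime_sum_shift m (G : nat -> R) :
    \sum_(p < m.+1 | prime p) G p = \sum_(i < m) (prime i.+1)%:R * G i.+1.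
  rewrite big_mkcond big_ord_recl /= add0r; apply: eq_bigr => i _.
  by rewrite /bump /= add1n; case: (prime _); rewrite ?mul1r ?mul0r.
rewrite /mertens_sum (prime_sum_shift x (fun p => F p * mertens_weight R x p)).
have -> : B = B * mertens_weight R x 1 by rewrite mertens_weight1 mulr1.
under eq_bigr do rewrite mulrA.
apply: (sum_mul_le_of_partial_sums (d := fun i => (prime i.+1)%:R * F i.+1)
  (w := fun i => mertens_weight R x i.+1)) => [i|i|m].
- exact: mertens_weight_ge0.
- by apply: mertens_weight_le; rewrite //= leqnSn.
- by rewrite -prime_sum_shift.
Qed.

Lemma prime_countE (R : realType) (P : nat -> Prop) m :
  (prime_count P m)%:R = \sum_(p < m.+1 | prime p) (`[< P p >])%:R :> R.
Proof.
rewrite /prime_count -sum1_card natr_sum.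
rewrite (eq_bigl (fun p : 'I_m.+1 => prime p && `[< P p >])) => [|p];
  last by rewrite inE.
by rewrite big_mkcondr; apply: eq_bigr => p _; case: `[< _ >].
Qed.

Definition relative_density1 (R : realType) (P : nat -> Prop) : Prop :=
  ((fun m : nat => (prime_count P m)%:R / (prime_count (fun _ => True) m)%:R : R)
    @ \oo --> (1 : R))%classic.

Lemma mertens_sum_compl_le_of_density1 (R : realType) (P : nat -> Prop) (eps : R) :
    0 < eps -> relative_density1 R P ->
  exists B : R, forall x, 1 <= ln (x%:R : R) ->
    mertens_sum x (fun p => (~~ `[< P p >])%:R)
      <= B + eps * mertens_sum x (fun=> 1).
Proof.
move=> eps_gt0 /cvgrPdist_lt /(_ eps eps_gt0) [m0 _ density_near].
exists m0.+1%:R => x ln_x; rewrite -lerBlDr -mertens_sumZ -mertens_sumB.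
apply: mertens_sum_le_of_partial_sums ln_x _ => m; rewrite sumrB.
have [m0m|mm0] := leqP m0 m; last first.
  apply: le_trans (_ : m.+1%:R <= _); last by rewrite ler_nat ltnS ltnW.
  rewrite lerBlDr -[leLHS]addr0; apply: lerD;
    last by apply: sumr_ge0 => *; rewrite mulr1 ltW.
  rewrite -[X in _ <= X%:R]card_ord -sum1_card natr_sum big_mkcond;
    apply: ler_sum => p _.
  by case: ifP => // _; case: (~~ _).
apply: le_trans (ler0n R m0.+1); have := density_near m m0m.
rewrite /= !prime_countE; set hits := \sum_(p < m.+1 | prime p) (`[< P p >])%:R.
rewrite -mulr_sumr; set primes : R := \sum_(p < m.+1 | prime p) 1.
have -> : \sum_(p < m.+1 | prime p) (`[< True >])%:R = primes.
  by apply: eq_bigr => p _; rewrite (asboolT I).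
move=> near1.
have -> : \sum_(p < m.+1 | prime p) (~~ `[< P p >])%:R = primes - hits.
  by rewrite -sumrB; apply: eq_bigr => p _; case: `[< _ >];
    rewrite ?subrr ?subr0.
have [primes0|primes_neq0] := eqVneq primes 0.
  by rewrite primes0 mulr0 subr0 sub0r oppr_le0 sumr_ge0.
have primes_gt0 : 0 < primes by rewrite lt_neqAle eq_sym primes_neq0 sumr_ge0.
have := le_lt_trans (ler_norm _) near1.
by rewrite -(ltr_pM2r primes_gt0) mulrBl mulfVK // mul1r; lra.
Qed.

Section Independent.
Variables (q k : nat) (a : 'I_k -> int) (A : {fset int}).
Hypotheses (pr_q : prime q) (indep : indep_mod_powers q a).
Hypothesis A_sub : forall z, z \in A -> exists i, z = a i.
Local Notation P := (contains_qth_power_mod q A).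

Lemma kummer_sum_le_exceptional (R : realType) p : prime p ->
  kummer_sum R q a p <= (#|{: {ffun 'I_k -> 'F_q}}| * (q * q.+1))%:R *
    ((~~ `[< P p >])%:R + (p %| \prod_i `|a i|)%N%:R).
Proof.
move=> pr_p; set bound := (_ * _)%:R.
have le_bound c : 1 <= c -> kummer_sum R q a p <= bound * c.
  by move=> c1; apply: le_trans (kummer_sum_le R a pr_q pr_p) _;
    rewrite ler_peMr.
have [p_dvd|p_ndvd] := boolP (p %| \prod_i `|a i|)%N.
  by apply: le_bound; rewrite lerDr.
rewrite addr0; case: (boolP `[< P p >]) => [/asboolP [z zA z_power]|_];
  last exact: le_bound.
have [i zi] := A_sub zA;
  rewrite mulr0 (@kummer_sum_eq0 R q k a pr_q p i) // -?zi //.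
by apply: contra p_ndvd => p_z; rewrite (bigD1 i) //= dvdn_mulr // -zi.
Qed.

Lemma indep_mod_powers_not_density1 (R : realType) :
  ~ relative_density1 R P.
Proof.
move=> density1.
pose M : R := (#|{: {ffun 'I_k -> 'F_q}}| * (q * q.+1))%:R.
have M_gt0 : 0 < M.
  by rewrite ltr0n !muln_gt0 (prime_gt0 pr_q) andbT; apply/card_gt0P; exists 0.
have eps_gt0 : 0 < (2 * M)^-1 by rewrite invr_gt0 mulr_gt0.
pose dvd_a p := (p %| \prod_i `|a i|)%N.
have dvd_a_le p : prime p -> dvd_a p -> (p <= \prod_i `|a i|)%N.
  move=> _; apply: dvdn_leq; rewrite prodn_gt0 // => i.
  by rewrite absz_gt0 (indep_mod_powers_neq0 pr_q _ indep).
have [B P_bound] := mertens_sum_compl_le_of_density1 eps_gt0 density1.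
have [C1 near_1] := mertens_sum1 R.
have [C near_kummer] := mertens_sum_kummer_sum_ge R pr_q indep.
near \oo%classic => x.
have ln_x : 1 <= ln (x%:R : R) by near: x; apply: near_ln_ge.
have := mertens_sum_indicator_le ln_x dvd_a_le;
  set D : R := _.+1%:R => dvd_a_bound.
have : 2 * (C + M * B + `|C1| + M * D) + 1 <= ln (ln (x%:R : R)).
  by near: x; apply: near_lnln_ge.
have : ln (ln (x%:R : R)) - C <= mertens_sum x (kummer_sum R q a) by near: x.
have : mertens_sum x (kummer_sum R q a) <=
    M * (mertens_sum x (fun p => (~~ `[< P p >])%:R)
      + mertens_sum x (fun p => (dvd_a p)%:R)).
  rewrite -mertens_sumD -mertens_sumZ; apply: ler_mertens_sum => p.
  exact: kummer_sum_le_exceptional.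
have : mertens_sum x (fun=> 1) <= ln (ln (x%:R : R)) + `|C1|.
  have : `|mertens_sum x (fun=> 1) - ln (ln (x%:R : R))| <= C1 by near: x.
  by have := ler_norm C1; rewrite ler_norml => ? /andP [_ ?]; lra.
have : M * mertens_sum x (fun p => (~~ `[< P p >])%:R) <=
    M * B + 2^-1 * mertens_sum x (fun=> 1).
  have := ler_wpM2l (ltW M_gt0) (P_bound x ln_x); rewrite mulrDr mulrA.
  by rewrite [M * _^-1](_ : _ = 2^-1) // invfM mulrCA mulfV ?mulr1 ?gt_eqF.
have := ler_wpM2l (ltW M_gt0) dvd_a_bound; rewrite mulrDr.
by have := normr_ge0 C1; lra.
Unshelve. all: by end_near. Qed.

Lemma indep_mod_powers_not_ae : ~ qth_power_ae q A.
Proof. exact: indep_mod_powers_not_density1. Qed.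

End Independent.

(** * Counting dependent sets *)

Definition agree_off (X : eqType) k (i : 'I_k) (t t' : {ffun 'I_k -> X}) :=
  [forall j, (j != i) ==> (t' j == t j)].

Lemma card_le_agree_off (X : finType) k (i : 'I_k)
    (W : {set {ffun 'I_k -> X}}) L :
    {in W, forall t,
      (#|[set t' i | t' : {ffun 'I_k -> X} in W & agree_off i t t']| <= L)%N} ->
  (#|W| <= L * #|X| ^ k.-1)%N.
Proof.
move=> W_le.
pose rest (t : {ffun 'I_k -> X}) : {ffun {j : 'I_k | j != i} -> X} :=
  [ffun j => t (val j)].
have agree_of_rest t t' : rest t' = rest t -> agree_off i t t'.
  move=> /ffunP E; apply/forallP => j; apply/implyP => ji.
  by have := E (exist _ j ji); rewrite !ffunE /= => ->.
have -> : (#|X| ^ k.-1)%N = #|[set: {ffun {j : 'I_k | j != i} -> X}]|.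
  by rewrite cardsT card_ffun card_sig cardC1 card_ord.
apply: (card_le_fibers (fiber := fun r => [set t in W | rest t == r])) =>
  [t tW|r _].
  by exists (rest t); rewrite // inE tW eqxx.
have [->|[t0]] := set_0Vmem [set t in W | rest t == r]; first by rewrite cards0.
rewrite inE => /andP [t0W /eqP t0r]; apply: leq_trans (W_le t0 t0W).
rewrite -(card_in_imset (f := fun t : {ffun 'I_k -> X} => t i)) => [|t t'].
  apply/subset_leq_card/subsetP => _ /imsetP [t + ->];
    rewrite inE => /andP [tW /eqP tr].
  by apply/imsetP; exists t; rewrite // inE tW agree_of_rest // tr.
rewrite !inE => /andP [_ /eqP tr] /andP [_ /eqP t'r] tt'i.
apply/ffunP => j; have [->|ji] := eqVneq j i; first exact: tt'i.
have /forallP /(_ j) : agree_off i t' t by apply: agree_of_rest; rewrite tr.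
by rewrite ji => /eqP.
Qed.

Lemma coprime_modn_mulI q e l l' : coprime q e ->
  (e * l = e * l' %[mod q] -> l = l' %[mod q])%N.
Proof.
move=> cop; wlog le : l l' / (l' <= l)%N => [th E|/eqP].
  by have [/th|/ltnW /th] := leqP l' l; [apply | move=> th'; apply/esym/th'].
rewrite eqn_mod_dvd ?leq_mul2l ?le ?orbT // -mulnBr Gauss_dvdr // => qd.
by apply/eqP; rewrite eqn_mod_dvd.
Qed.

Definition same_valuations (q : nat) (x y : int) : Prop :=
  [/\ x != 0, y != 0 & forall p, logn p `|x| = logn p `|y| %[mod q]].

Lemma logn_kummer_prod q k (a : 'I_k -> int) (e : {ffun 'I_k -> 'F_q}) p :
    (forall i, a i != 0) ->
  logn p `|kummer_prod a e| = (\sum_i (e i : nat) * logn p `|a i|)%N.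
Proof.
move=> a0; rewrite /kummer_prod (big_morph absz abszM (erefl _))
  logn_prod => [|i _].
  by apply: eq_bigr => i _; rewrite abszX lognX.
by rewrite abszX expn_gt0 absz_gt0 a0.
Qed.

Lemma same_valuations_of_power_relation q k (a b : 'I_k -> int)
    (e : {ffun 'I_k -> 'F_q}) i :
    prime q -> e i != 0 -> (forall j, a j != 0) -> (forall j, b j != 0) ->
    (forall j, j != i -> a j = b j) ->
    power_relation a e -> power_relation b e ->
  same_valuations q (a i) (b i).
Proof.
move=> pr_q ei0 a0 b0 ab aP bP; split=> // p.
have q_dvd c : (forall j, c j != 0) -> power_relation c e ->
    (q %| \sum_j (e j : nat) * logn p `|c j|)%N.
  by move=> c0 [m mE]; rewrite -logn_kummer_prod // -mE abszX lognX dvdn_mulr.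
have cop : coprime q (e i : nat).
  rewrite prime_coprime //; apply: contra ei0 => q_ei.
  have ei_lt : (e i < q)%N.
    by have := ltn_ord (e i); rewrite [X in (_ < X)%N](Fp_cast pr_q).
  case: (posnP (e i : nat)) => [ei0|ei_gt0]; first exact/eqP/val_inj.
  by have := dvdn_leq ei_gt0 q_ei; rewrite leqNgt ei_lt.
apply: (coprime_modn_mulI cop); apply/eqP.
rewrite -(eqn_modDr (\sum_(j | j != i) (e j : nat) * logn p `|b j|)%N).
have rest_eq : (\sum_(j | j != i) (e j : nat) * logn p `|a j| =
    \sum_(j | j != i) (e j : nat) * logn p `|b j|)%N.
  by apply: eq_bigr => j /ab ->.
have := q_dvd a a0 aP; rewrite (bigD1 i) //= rest_eq => /eqP ->.
by have := q_dvd b b0 bP; rewrite (bigD1 i) //= => /eqP ->.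
Qed.

Lemma power_relation_of_qth_power_ae q k (A : {fset int}) (a : 'I_k -> int) :
    prime q -> qth_power_ae q A -> (forall z, z \in A -> exists i, z = a i) ->
  exists2 e : {ffun 'I_k -> 'F_q}, e != 0 & power_relation a e.
Proof.
move=> pr_q A_ae A_sub; apply: contrapT => no_relation.
apply: indep_mod_powers_not_ae pr_q _ A_sub A_ae => e e0 e_rel.
by apply: no_relation; exists e.
Qed.

Section CountDependent.
Variables (q k : nat) (X : {fset int}) (L : nat).
Hypothesis pr_q : prime q.
Hypothesis class_le : forall y : X,
  (#|[set x : X | `[< same_valuations q (val x) (val y) >]]| <= L)%N.

Definition vals (t : {ffun 'I_k -> X}) (j : 'I_k) : int := val (t j).

Definition dependent_tuples (ei : {ffun 'I_k -> 'F_q} * 'I_k) :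
    {set {ffun 'I_k -> X}} :=
  [set t | (vals t ei.2 == 0) ||
    [&& ei.1 ei.2 != 0, [forall j, vals t j != 0] &
      `[< power_relation (vals t) ei.1 >]]].

Lemma card_dependent_tuples_le ei :
  (#|dependent_tuples ei| <= L.+1 * #|` X| ^ k.-1)%N.
Proof.
case: ei => e i; set W := dependent_tuples _; rewrite cardfE.
apply: (@card_le_agree_off _ _ i) => t _.
set values := [set _ | _ in _]; pose zeros := [set x : X | val x == 0].
have zeros_le1 : (#|zeros| <= 1)%N.
  apply/card_le1_eqP => x y; rewrite !inE => /eqP x0 /eqP y0.
  by apply: val_inj; rewrite x0 y0.
have nonzeroP t1 : t1 \in W -> t1 i \notin zeros ->
    [/\ e i != 0, forall j, vals t1 j != 0 & power_relation (vals t1) e].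
  rewrite !inE =>
    /orP [/= -> //|/and3P [ei0 /forallP t1_neq0 /asboolP t1_rel] _].
  by [].
have [no_nonzero|[y]] := set_0Vmem (values :\: zeros).
  apply: leq_trans (leq_trans zeros_le1 (ltn0Sn L)); apply/subset_leq_card.
  by rewrite -setD_eq0 no_nonzero.
rewrite inE => /andP [y_nonzero /imsetP [t1]];
  rewrite inE => /andP [t1W /forallP t1_agree] yE.
rewrite yE in y_nonzero; have [ei0 t1_neq0 t1_rel] := nonzeroP t1 t1W y_nonzero.
apply: (@leq_trans
  #|zeros :|: [set x : X | `[< same_valuations q (val x) (val y) >]]|).
  apply/subset_leq_card/subsetP => _ /imsetP [t2 + ->]; rewrite inE.
  move=> /andP [t2W /forallP t2_agree]; rewrite in_setU; apply/orP.
  have [|t2_nonzero] := boolP (t2 i \in zeros);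
    [by left | right; rewrite inE; apply/asboolP].
  have [_ t2_neq0 t2_rel] := nonzeroP t2 t2W t2_nonzero; rewrite yE.
  apply: (same_valuations_of_power_relation pr_q ei0 t2_neq0 t1_neq0 _ t2_rel
    t1_rel) => j ji.
  by move: (t1_agree j) (t2_agree j); rewrite ji /vals /= => /eqP -> /eqP ->.
by apply: leq_trans (leq_card_setU _ _) _; rewrite -add1n leq_add.
Qed.

Lemma ex_dependent_tuple A : (A `<=` X)%fset -> S_qk q k A ->
  exists ei t,
    t \in dependent_tuples ei /\ A = [fset vals t j | j in 'I_k]%fset.
Proof.
move=> /fsubsetP AX [A_card A_ae].
have nth_in (i : 'I_k) : nth 0 (enum_fset A) i \in X.
  by apply/AX/mem_nth; rewrite A_card.
pose t : {ffun 'I_k -> X} := [ffun i => [` nth_in i]%fset].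
have tE i : vals t i = nth 0 (enum_fset A) i by rewrite /vals ffunE.
have A_sub z : z \in A -> exists i, z = vals t i.
  move=> zA; have zk : (index z (enum_fset A) < k)%N.
    by rewrite -A_card index_mem.
  by exists (Ordinal zk); rewrite tE /= nth_index.
have A_image : A = [fset vals t j | j in 'I_k]%fset.
  apply/fsetP => z; apply/idP/imfsetP => [/A_sub [i ->]|[i _ ->]];
    first by exists i.
  by rewrite tE mem_nth // A_card.
have [e e0 t_rel] := power_relation_of_qth_power_ae pr_q A_ae A_sub.
have [/forallP t_neq0|] := boolP [forall j, vals t j != 0]; last first.
  rewrite negb_forall => /existsP [j]; rewrite negbK => tj0.
  by exists (e, j), t; split; rewrite // inE tj0.
have [i ei0] : exists i, e i != 0.
  apply/existsP; apply: contraR e0; rewrite negb_exists => /forallP e_eq0.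
  by apply/eqP/ffunP => i; rewrite ffunE; apply/eqP/negPn/e_eq0.
exists (e, i), t; split=> //; rewrite inE ei0 /=; apply/orP; right.
by apply/andP; split; [apply/forallP | apply/asboolP].
Qed.

Lemma count_S_le : (count_S q k X <= q ^ k * k * (L.+1 * #|` X| ^ k.-1))%N.
Proof.
pose tuples :=
  [set t : {ffun 'I_k -> X} | [exists ei, t \in dependent_tuples ei]].
have tuples_le : (#|tuples| <= L.+1 * #|` X| ^ k.-1
  * #|[set: {ffun 'I_k -> 'F_q} * 'I_k]|)%N.
  apply: (card_le_fibers (fiber := dependent_tuples)) => [t|ei _].
    by rewrite inE => /existsP [ei t_dep]; exists ei.
  exact: card_dependent_tuples_le.
have /fsubset_leq_card image_le : ([fset A in fpowerset X | `[< S_qk q k A >]]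
    `<=` [fset [fset vals t j | j in 'I_k] | t in tuples])%fset.
  apply/fsubsetP => A; rewrite !inE fpowersetE => /andP [AX /asboolP A_S].
  have [ei [t [t_dep ->]]] := ex_dependent_tuple AX A_S.
  by apply/imfsetP; exists t; rewrite // inE; apply/existsP; exists ei.
rewrite mulnC; apply: leq_trans image_le (leq_trans (leq_imfset_card _ _ _) _).
by move: tuples_le;
  rewrite cardsT card_prod card_ffun card_Fp // !card_ord cardE.
Qed.

End CountDependent.

Definition root_part (q c : nat) : nat :=
  (\prod_(0 <= p < c.+1) p ^ (logn p c %/ q))%N.

Lemma logn_root_part q c p : logn p (root_part q c) = (logn p c %/ q)%N.
Proof.
rewrite /root_part big_mkord logn_prod => [|i _]; last first.
  by rewrite expn_gt0; case: (posnP i) => // ->; rewrite lognE div0n.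
have [pr_p|np] := boolP (prime p); last first.
  by rewrite [in RHS]lognE (negPf np) div0n big1 // => i _;
    rewrite lognE (negPf np).
have logn_factor (i : nat) :
    logn p (i ^ (logn i c %/ q)) = (if i == p then logn p c %/ q else 0)%N.
  have [->|ip] := eqVneq i p;
    first by rewrite lognX (logn_prime _ pr_p) eqxx muln1.
  rewrite lognX; have [pr_i|ni] := boolP (prime i).
    by rewrite (logn_prime _ pr_i) eq_sym (negPf ip) muln0.
  by rewrite [logn i c]lognE (negPf ni) div0n.
under eq_bigr do rewrite logn_factor; rewrite -big_mkcond.
have [pc|cp] := leqP p c;
  first by rewrite (big_pred1 (Ordinal (pc : p < c.+1)%N)).
rewrite big_pred0 => [|i];
  last by rewrite ltn_eqF // (leq_trans (ltn_ord i) cp).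
by rewrite lognE; case: posnP => [|c0];
  rewrite ?andbF ?div0n //= gtnNdvd ?andbF ?div0n.
Qed.

Lemma exp_root_part_le q c : (0 < c)%N -> (root_part q c ^ q <= c)%N.
Proof.
move=> c0; rewrite -[leqRHS](partnT c0) /root_part.
rewrite (big_morph (expn ^~ q) (fun a b => expnMn a b q) (exp1n q)).
rewrite /partn big_nat [leqRHS]big_nat; apply: leq_prod => p _; rewrite -expnM.
have [->|p0] := posnP p; first by rewrite lognE div0n.
by rewrite leq_pexp2l // leq_divM.
Qed.

Lemma absz_eq_of_root_part q x y :
    (forall p, logn p `|x| = logn p `|y| %[mod q]) ->
  x != 0 -> y != 0 -> root_part q `|x| = root_part q `|y| -> `|x|%N = `|y|%N.
Proof.
move=> xy x0 y0 root_xy; apply: eqn_from_log; rewrite ?absz_gt0 // => p.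
rewrite (divn_eq (logn p `|x|) q) (divn_eq (logn p `|y|) q) -!logn_root_part.
by rewrite root_xy xy.
Qed.

Lemma card_same_valuations_le (X : {fset int}) q (y : X) (T : finType)
    (h : X -> T) :
    (forall x x' : X, same_valuations q (val x) (val y) ->
       same_valuations q (val x') (val y) ->
       h x = h x' -> `|val x|%N = `|val x'|%N) ->
  (#|[set x : X | `[< same_valuations q (val x) (val y) >]]| <= 2 * #|T|)%N.
Proof.
move=> h_inj; pose signed_h (x : X) := ((0 < val x)%R, h x).
rewrite -(card_in_imset (f := signed_h)) => [|x x'].
  by apply: leq_trans (max_card _) _; rewrite card_prod card_bool.
rewrite !inE => /asboolP x_cl /asboolP x'_cl [sgE /(h_inj _ _ x_cl x'_cl) absE].
case: x_cl x'_cl => x0 _ _ [x'0 _ _]; apply: val_inj; move: sgE absE x0 x'0.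
by rewrite /=; move: (fsval x) (fsval x') => [m|m] [m'|m'] /=; lia.
Qed.

Lemma absz_add_box_le N x : x \in add_box N -> (`|x| <= N)%N.
Proof.
by case/imfsetP => i; rewrite inE mem_iota => ? ->; lia.
Qed.

Lemma card_add_box_le N : (#|` add_box N| <= (2 * N).+1)%N.
Proof.
apply: leq_trans (leq_imfset_card _ _ _) _.
by apply: leq_trans (size_undup _) _; rewrite size_iota.
Qed.

Lemma add_box_class_le N q s (y : add_box N) : (0 < q)%N -> (N < s.+1 ^ q)%N ->
  (#|[set x : add_box N | `[< same_valuations q (val x) (val y) >]]|
    <= 2 * s.+1)%N.
Proof.
move=> q0 Ns; rewrite -[X in (_ <= 2 * X)%N]card_ord.
have root_lt (x : add_box N) : val x != 0 -> (root_part q `|val x| < s.+1)%N.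
  move=> x0; rewrite -(ltn_exp2r _ _ q0); apply: leq_ltn_trans Ns.
  by apply: leq_trans (exp_root_part_le _ _) (absz_add_box_le (valP x));
    rewrite absz_gt0.
apply: (@card_same_valuations_le _ _ _ _
  (fun x => inord (root_part q `|val x|) : 'I_s.+1)).
move=> x x' [x0 _ xy] [x'0 _ x'y] /(congr1 val); rewrite /= !inordK ?root_lt //.
by apply: absz_eq_of_root_part => // p; rewrite xy x'y.
Qed.

Lemma prime_nth_prime i : prime (nth_prime i).
Proof.
by case: i => //= i; rewrite /next_prime; case: ex_minnP => p /andP [].
Qed.

Lemma nth_prime_inj : injective nth_prime.
Proof.
have incr i j : (i < j)%N -> (nth_prime i < nth_prime j)%N.
  apply: (homo_ltn (r := fun m n => (m < n)%N)) => [m l n|{}i];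
    first exact: ltn_trans.
  by rewrite /= /next_prime; case: ex_minnP => p /andP [].
by move=> i j E; case: (ltngtP i j) => // /incr; rewrite E ltnn.
Qed.

Lemma absz_mul_elt N (x : bool * {ffun 'I_N -> 'I_N.+1}) :
  `|mul_elt x|%N = (\prod_(i < N) nth_prime i ^ x.2 i)%N.
Proof.
rewrite /mul_elt abszM abszX abszN exp1n mul1n (big_morph absz abszM (erefl _)).
by apply: eq_bigr => i _; rewrite abszX.
Qed.

Lemma logn_mul_elt N (x : bool * {ffun 'I_N -> 'I_N.+1}) (i : 'I_N) :
  logn (nth_prime i) `|mul_elt x| = x.2 i.
Proof.
rewrite absz_mul_elt logn_prod => [|j _];
  last by rewrite expn_gt0 prime_gt0 ?prime_nth_prime.
rewrite (bigD1 i) //= lognX logn_prime ?prime_nth_prime // eqxx muln1.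
rewrite big1 ?addn0 // => j ji; rewrite lognX logn_prime ?prime_nth_prime //.
by rewrite (inj_eq nth_prime_inj) eq_sym val_eqE (negPf ji) muln0.
Qed.

Lemma card_mul_box_le N : (#|` mul_box N| <= 2 * N.+1 ^ N)%N.
Proof.
apply: leq_trans (leq_imfset_card _ _ _) _.
by apply: leq_trans (size_undup _) _;
  rewrite -cardE cardsT card_prod card_bool card_ffun !card_ord.
Qed.

Lemma mul_box_class_le N q (y : mul_box N) : (0 < q)%N ->
  (#|[set x : mul_box N | `[< same_valuations q (val x) (val y) >]]|
    <= 2 * (N %/ q).+1 ^ N)%N.
Proof.
move=> q0; have mul_eltP (x : mul_box N) :
    exists u : bool * {ffun 'I_N -> 'I_N.+1}, val x = mul_elt u.
  by have /imfsetP [u _ ->] := valP x; exists u.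
have -> : ((N %/ q).+1 ^ N)%N = #|{: {ffun 'I_N -> 'I_(N %/ q).+1}}|.
  by rewrite card_ffun !card_ord.
apply: (@card_same_valuations_le _ _ _ _ (fun x =>
  [ffun i : 'I_N =>
    inord (logn (nth_prime i) `|val x| %/ q) : 'I_(N %/ q).+1])).
move=> x x' [_ _ xy] [_ _ x'y] /ffunP E; have [u uE] := mul_eltP x;
  have [v vE] := mul_eltP x'.
rewrite uE vE !absz_mul_elt; apply: eq_bigr => i _; congr (_ ^ _)%N.
rewrite -!logn_mul_elt -uE -vE.
have div_lt (w : bool * {ffun 'I_N -> 'I_N.+1}) :
    (logn (nth_prime i) `|mul_elt w| %/ q < (N %/ q).+1)%N.
  by rewrite logn_mul_elt ltnS leq_div2r // -ltnS.
have := congr1 val (E i);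
  rewrite !ffunE /= !inordK ?uE ?vE // -uE -vE => div_eq.
by rewrite (divn_eq (logn _ `|val x|) q) (divn_eq (logn _ `|val x'|) q)
  div_eq xy x'y.
Qed.

Lemma leq_exp2rW m n e : (m <= n)%N -> (m ^ e <= n ^ e)%N.
Proof. by case: e => // e mn; rewrite leq_exp2r. Qed.

Lemma count_S_add_box_le q k N s :
    prime q -> (0 < N)%N -> (s ^ q <= N < s.+1 ^ q)%N ->
  (count_S q k (add_box N) <= q ^ k * k * (5 * 3 ^ k.-1) * (s * N ^ k.-1))%N.
Proof.
move=> pr_q N0 /andP [_ Ns]; have q0 := prime_gt0 pr_q.
have s0 : (0 < s)%N by case: s Ns => //; rewrite exp1n ltnS leqNgt N0.
apply: leq_trans (count_S_le k pr_q (fun y => add_box_class_le y q0 Ns)) _.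
rewrite -[leqRHS]mulnA leq_mul2l mulnACA -expnMn; apply/orP; right.
apply: leq_mul; first by lia.
by rewrite leq_exp2rW // (leq_trans (card_add_box_le N)) //; lia.
Qed.

Lemma count_S_mul_box_le q k N : prime q ->
  (count_S q k (mul_box N) <=
   q ^ k * k * (3 * 2 ^ k.-1) * ((N %/ q).+1 ^ N * (N.+1 ^ N) ^ k.-1))%N.
Proof.
move=> pr_q; have q0 := prime_gt0 pr_q.
apply: leq_trans (count_S_le k pr_q (fun y => mul_box_class_le y q0)) _.
rewrite -[leqRHS]mulnA leq_mul2l mulnACA -expnMn; apply/orP; right.
apply: leq_mul; last by rewrite leq_exp2rW ?card_mul_box_le.
by have : (0 < (N %/ q).+1 ^ N)%N; [rewrite expn_gt0 | lia].
Qed.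

(** * Densities *)

Lemma exp_sub_le_ffact n k : ((n - k) ^ k <= n ^_ k)%N.
Proof.
elim: k n => [|k IH] [|n]; rewrite ?expn0 ?exp0n //.
by rewrite expnS ffactnS leq_mul ?leq_subr //= subSS IH.
Qed.

Lemma exp_le_bin b n k : (b + k <= n)%N -> (b ^ k <= 'C(n, k) * k`!)%N.
Proof.
move=> bn; rewrite bin_ffact; apply: leq_trans (exp_sub_le_ffact n k).
by rewrite leq_exp2rW // leq_subRL ?(leq_trans (leq_addl _ _) bn) // addnC.
Qed.

Lemma cvg_div_bin0 (R : realType) (k : nat) (c b n : nat -> nat) (g : nat -> R)
    (m : R) :
    0 <= m ->
    (\forall N \near \oo, (b N + k <= n N)%N)%classic ->
    (\forall N \near \oo, (c N)%:R <= m * ((b N)%:R ^+ k / g N))%classic ->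
    (g N @[N --> \oo] --> +oo)%classic ->
  ((c N)%:R / 'C(n N, k)%:R @[N --> \oo] --> (0 : R))%classic.
Proof.
move=> m0 bn c_le g_cvg.
have g_gt0 : (\forall N \near \oo, 0 < g N)%classic by apply: cvgry_gt.
have inv_g : (m * k`!%:R * (g N)^-1 @[N --> \oo] --> (0 : R))%classic.
  suff : (m * k`!%:R * (g N)^-1 @[N --> \oo] --> m * k`!%:R * 0)%classic.
    by rewrite mulr0.
  by apply: cvgM; [exact: cvg_cst | exact/gtr0_cvgV0].
apply: squeeze_cvgr (cvg_cst 0) inv_g; near=> N.
have gN : 0 < g N by near: N.
have bnN : (b N + k <= n N)%N by near: N.
have bin_gt0 : 0 < 'C(n N, k)%:R :> R.
  by rewrite ltr0n bin_gt0 (leq_trans (leq_addl _ _) bnN).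
rewrite divr_ge0 //= ler_pdivrMr //.
have cN : (c N)%:R <= m * ((b N)%:R ^+ k / g N) by near: N.
apply: le_trans cN _; rewrite -!mulrA ler_wpM2l // [leLHS]mulrC mulrCA.
by rewrite ler_wpM2l ?invr_ge0 ?(ltW gN) // mulrC -natrX -natrM
  ler_nat exp_le_bin.
Unshelve. all: by end_near. Qed.

Lemma expnD_le_expR (R : realType) (c N : nat) :
  (N + c)%:R ^+ N <= expR c%:R * N%:R ^+ N :> R.
Proof.
case: N => [|N].
  by rewrite !expr0 mulr1; apply: le_trans (expR_ge1Dx _); rewrite lerDl.
have N0 : 0 < N.+1%:R :> R by rewrite ltr0n.
have -> : (N.+1 + c)%:R = (1 + c%:R / N.+1%:R) * N.+1%:R :> R.
  by rewrite mulrDl mul1r mulfVK ?gt_eqF // natrD.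
rewrite exprMn ler_wpM2r ?exprn_ge0 //.
apply: (@le_trans _ _ (expR (c%:R / N.+1%:R) ^+ N.+1)).
  by rewrite lerXn2r ?nnegrE ?expR_ge0 ?expR_ge1Dx // addr_ge0 // divr_ge0.
by rewrite -expRM_natr mulfVK ?gt_eqF.
Qed.

Lemma natr_root_le_powR (R : realType) (s q N : nat) :
    (0 < q)%N -> (s ^ q <= N)%N ->
  s%:R <= N%:R `^ q%:R^-1 :> R.
Proof.
move=> q0 sN; have -> : s%:R = (s%:R ^+ q) `^ q%:R^-1 :> R.
  by rewrite -powR_mulrn // -powRrM mulfV ?powRr1 // pnatr_eq0 -lt0n.
by apply: ge0_ler_powR; rewrite ?nnegrE ?invr_ge0 ?exprn_ge0 // -natrX ler_nat.
Qed.

Section Densities.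
Variables (R : realType) (q k : nat).
Hypothesis pr_q : prime q.

Let q_gt0 : (0 < q)%N := prime_gt0 pr_q.

Lemma count_S_add_box_bound :
  exists a : R, 0 < a /\ forall N : nat, (1 <= N)%N ->
  (count_S q k (add_box N))%:R <= a * (N%:R `^ (k%:R - (1 - q%:R^-1))).
Proof.
exists ((q ^ k * k * (5 * 3 ^ k.-1))%N%:R + 1); split=> [|N N1];
  first by rewrite ltr_wpDl.
have [s] := ex_floor_root N q_gt0 (isT : (0 < 1)%N); rewrite !mul1n => s_root.
have := count_S_add_box_le k pr_q N1 s_root; rewrite -(ler_nat R) natrM.
case: k => [|k'] /le_trans; apply;
  first by rewrite muln0 mul0n mul0r mulr_ge0 ?powR_ge0 // addr_ge0.
have N_neq0 : N%:R != 0 :> R by rewrite pnatr_eq0 -lt0n.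
rewrite ler_pM ?lerDl // natrM natrX.
have -> : k'.+1%:R - (1 - q%:R^-1) = q%:R^-1 + k'%:R :> R.
  by rewrite -natr1; ring.
rewrite powRD ?N_neq0 ?implybT // powR_mulrn // ler_wpM2r ?exprn_ge0 //.
by apply: natr_root_le_powR; case/andP: s_root.
Qed.

Lemma add_density0 :
  ((fun N : nat => (count_S q k (add_box N))%:R / ('C((2 * N).+1, k))%:R : R)
    @ \oo --> (0 : R))%classic.
Proof.
have [a [a0 count_le]] := count_S_add_box_bound.
have delta_gt0 : 0 < 1 - q%:R^-1 :> R.
  by rewrite subr_gt0 invf_lt1 ?ltr0n // ltr1n prime_gt1.
apply: (@cvg_div_bin0 R k _ id (fun N => (2 * N).+1)
  (fun N => N%:R `^ (1 - q%:R^-1)) a).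
- exact: ltW.
- by near=> N; rewrite mul2n -addnn -addnS leq_add2l leqW //; near: N; exists k.
- near=> N; have N1 : (1 <= N)%N by near: N; exists 1%N.
  rewrite (le_trans (count_le N N1)) // ler_wpM2l ?(ltW a0) // powRB
    ?powR_mulrn //.
  by rewrite pnatr_eq0 -lt0n N1 implybT.
- apply/cvgryPge => B; near=> N; have N1 : (1 <= N)%N by near: N; exists 1%N.
  have lnN : B / (1 - q%:R^-1) <= ln (N%:R : R) by near: N; apply: near_ln_ge.
  rewrite /powR pnatr_eq0 gtn_eqF //; apply: le_trans (expR_ge1Dx _).
  by rewrite ler_pdivrMr // in lnN; rewrite mulrC; lra.
Unshelve. all: by end_near. Qed.

Lemma count_S_mul_box_bound : exists m : R, 0 < m /\ forall N : nat,
  (count_S q k (mul_box N))%:R <= m * (N%:R ^+ (N * k) / q%:R ^+ N).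
Proof.
have q_pow_gt0 N : 0 < q%:R ^+ N :> R by rewrite exprn_gt0 // ltr0n.
pose m : R := (q ^ k * k * (3 * 2 ^ k.-1))%N%:R * (expR q%:R * expR 1 ^+ k.-1).
have m_ge0 : 0 <= m by rewrite !mulr_ge0 ?exprn_ge0 ?expR_ge0.
exists (m + 1); split=> [|N]; first by rewrite ltr_wpDl.
apply: (@le_trans _ _ (m * (N%:R ^+ (N * k) / q%:R ^+ N))); last first.
  by rewrite ler_wpM2r ?lerDl // divr_ge0 ?exprn_ge0 // ltW.
have := count_S_mul_box_le k N pr_q.
rewrite -(ler_nat R) natrM => /le_trans; apply.
rewrite /m; case: k => [|k'] /=; first by rewrite muln0 mul0n !mul0r.
have quotient_le : ((N %/ q).+1 ^ N)%N%:R
  <= expR q%:R * (N%:R ^+ N / q%:R ^+ N) :> R.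
  rewrite mulrA ler_pdivlMr //; apply: le_trans (expnD_le_expR R q N).
  by rewrite -!natrX -natrM ler_nat -expnMn leq_exp2rW // mulSn addnC
    leq_add2r leq_divM.
have succ_le : ((N.+1 ^ N) ^ k')%N%:R <= (expR 1 * N%:R ^+ N) ^+ k' :> R.
  rewrite natrX lerXn2r ?nnegrE ?mulr_ge0 ?expR_ge0 ?exprn_ge0 //.
  by have := expnD_le_expR R 1 N; rewrite addn1 natrX.
rewrite -mulrA ler_wpM2l // natrM mulnS exprD exprM.
apply: le_trans (ler_pM _ _ quotient_le succ_le) _; rewrite // exprMn le_eqVlt.
by apply/orP; left; apply/eqP; ring.
Qed.

Lemma mul_density0 :
  ((fun N : nat => (count_S q k (mul_box N))%:R
    / ('C(2 * (N.+1 ^ N), k))%:R : R)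
    @ \oo --> (0 : R))%classic.
Proof.
have [m [m0 count_le]] := count_S_mul_box_bound.
apply: (@cvg_div_bin0 R k _ (fun N => N ^ N)%N (fun N => 2 * N.+1 ^ N)%N
  (fun N => q%:R ^+ N) m).
- exact: ltW.
- near=> N; rewrite mul2n -addnn leq_add ?leq_exp2rW //.
  have [N0 kN] : (0 < N)%N /\ (k <= N)%N.
    by split; near: N; [exists 1%N | exists k].
  by rewrite (leq_trans (leqW kN)) // -[leqLHS]expn1 leq_pexp2l.
- by near=> N; rewrite natrX -exprM.
- apply/cvgryPge => B; near=> N; apply: (@le_trans _ _ N%:R).
    by near: N; apply: nbhs_infty_ger.
  by rewrite -natrX ler_nat ltnW // ltn_expl // prime_gt1.
Unshelve. all: by end_near. Qed.

End Densities.

Theorem theorem1 (q k : nat) : prime q ->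
  add_subset_density q k 0 /\
  (exists a : RR, 0 < a /\
     forall N : nat, (1 <= N)%N ->
       (count_S q k (add_box N))%:R <= a * (N%:R `^ (k%:R - (1 - q%:R^-1)))) /\
  mul_subset_density q k 0 /\
  (exists m : RR, 0 < m /\
     forall N : nat,
       (count_S q k (mul_box N))%:R <= m * (N%:R ^+ (N * k) / q%:R ^+ N)).
Proof.
move=> pr_q; split;
  [exact: add_density0 | split; [exact: count_S_add_box_bound |]].
by split; [exact: mul_density0 | exact: count_S_mul_box_bound].
Qed.
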